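(* Let $(s,p)\in\mathbb C^2$. Then $(s,p)\in\Gamma\setminus b\Gamma$ if and only if $|p|\neq 1$ and $|s-\overline{s}p|+|p|^2\leq 1$.
   Context: The closed symmetrized bidisc is $\Gamma=\{(z_1+z_2,\,z_1z_2) : z_1,z_2\in\mathbb C,\ |z_1|\leq 1,\ |z_2|\leq 1\}\subset\mathbb C^2$, and $b\Gamma$ denotes its distinguished boundary (the Shilov boundary of $\Gamma$ with respect to the algebra of functions continuous on $\Gamma$ and holomorphic in its interior); it is known that $b\Gamma=\{(z_1+z_2,\,z_1z_2): |z_1|=|z_2|=1\}=\{(s,p)\in\Gamma : |p|=1\}$. *)

(* Defs.v *)
From Stdlib Require Import Reals.
From Coquelicot Require Export Coquelicot.

Open Scope C_scope.

Definition Gamma (x : C * C) : Prop :=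
  exists z1 z2 : C,
    (Cmod z1 <= 1)%R /\ (Cmod z2 <= 1)%R /\ x = (z1 + z2, z1 * z2).

(* Functions are total on [C * C], but only their values on [K] matter.
   Differentiability is over [C_AbsRing]: the Fréchet differential is
   C-linear, so this is holomorphy in two complex variables.  The condition
   [locally x K] says that [x] is an interior point of [K]. *)
Definition holo_algebra (K : C * C -> Prop) (f : C * C -> C) : Prop :=
  continuous_on K f /\
  forall x : C * C, locally x K ->
    ex_filterdiff (K := C_AbsRing)
      (U := prod_NormedModule C_AbsRing C_NormedModule C_NormedModule)
      (V := C_NormedModule) f (locally x).

Definition closed_boundary {T : UniformSpace} (K : T -> Prop)
    (A : (T -> C) -> Prop) (E : T -> Prop) : Prop :=
  closed E /\ (forall x : T, E x -> K x) /\
  forall f : T -> C, A f ->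
    exists y : T, E y /\ forall x : T, K x -> (Cmod (f x) <= Cmod (f y))%R.

(* The smallest closed boundary, as the intersection of all of them. *)
Definition shilov_boundary {T : UniformSpace} (K : T -> Prop)
    (A : (T -> C) -> Prop) (x : T) : Prop :=
  forall E : T -> Prop, closed_boundary K A E -> E x.

Definition bGamma : C * C -> Prop :=
  shilov_boundary Gamma (holo_algebra Gamma).

(* Main.v *)
Require Import Defs.
From Stdlib Require Import Reals Lra Psatz Lia ClassicalEpsilon.
From Coquelicot Require Import Coquelicot.
Local Open Scope C_scope.

(* The distinguished boundary is the image of the torus under symmetrization.
   That image is a closed boundary by the maximum principle: a Moebius disc
   joins a point of the open bidisc to the torus, and if [h] is the function
   along that disc, Goursat's theorem for the [2 i pi]-periodic [h (exp w)] on
   the rectangles [[a, b] x [0, 2 pi]] makes its vertical means constant.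
   Conversely every point [(s0, p0)] of the torus image is a peak point, for
   [p (16 p - (s - s0) (s - conj s0 p) + 16 p0)]: on the torus [s = conj s p],
   so the middle product equals [p |s - s0|^2], and the factor [p] makes the
   modulus strictly smaller off the torus.  By the identity
   [s - conj s p = z1 (1 - |z2|^2) + z2 (1 - |z1|^2)], with [a = |z1|] and
   [b = |z2|], the inequality amounts to [(1 - a) (1 - b) >= 0]. *)

(** * Goursat's theorem on rectangles *)

(** Since [bGamma] is an intersection over all closed boundaries, identifying it takes one small
    closed boundary and, for each of its points, a function whose modulus on [Gamma] is maximal only
    there. The obstacle in the first half is regularity: a function of the algebra is differentiable
    only at interior points of [Gamma], with no continuity of the derivative given, and on the
    boundary it is merely continuous relative to [Gamma]. Hence Goursat's subdivision, means over
    circles strictly inside the disc, and a passage to the unit circle by compactness. The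
    exponential turns those circles into vertical segments, so integrals along axis-parallel sides
    suffice, and periodicity cancels the horizontal ones. In the second half a peak at s0 suggests
    |s - s0|^2, which is not holomorphic; on the torus conj s is the polynomial's business of p and
    s, and 16 = 4^2 dominates |s - s0|^2 because |s| and |s0| are at most 2. *)

Definition cdiff (h : C -> C) (z l : C) : Prop :=
  forall eps : R, (0 < eps)%R -> exists delta : R, (0 < delta)%R /\
    forall w : C, (Cmod (w - z) < delta)%R ->
      (Cmod (h w - h z - l * (w - z)) <= eps * Cmod (w - z))%R.

Lemma cdiff_continuous (h : C -> C) (z l : C) : cdiff h z l ->
  forall eps : R, (0 < eps)%R -> exists delta : R, (0 < delta)%R /\
    forall w : C, (Cmod (w - z) < delta)%R -> (Cmod (h w - h z) < eps)%R.
Proof.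
  intros Hh eps Heps.
  destruct (Hh 1%R Rlt_0_1) as [d [Hd H]].
  pose proof (Cmod_ge_0 l) as Hl.
  exists (Rmin d (eps / (2 + Cmod l))). split.
  { apply Rmin_pos; [assumption|]. apply Rdiv_lt_0_compat; lra. }
  intros w Hw.
  pose proof (Rlt_le_trans _ _ _ Hw (Rmin_l _ _)) as H1.
  pose proof (Rlt_le_trans _ _ _ Hw (Rmin_r _ _)) as H2.
  specialize (H w H1).
  replace (h w - h z) with ((h w - h z - l * (w - z)) + l * (w - z)) by ring.
  eapply Rle_lt_trans; [apply Cmod_triangle|]. rewrite Cmod_mult.
  apply (Rmult_lt_compat_r (2 + Cmod l)) in H2; [|lra].
  unfold Rdiv in H2. rewrite Rmult_assoc, Rinv_l in H2 by lra.
  pose proof (Cmod_ge_0 (w - z)). nra.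
Qed.

Definition hint (H : C -> C) (a b y : R) : C :=
  RInt (V := C_R_CompleteNormedModule) (fun x => H (x, y)) a b.

Definition vint (H : C -> C) (x c d : R) : C :=
  RInt (V := C_R_CompleteNormedModule) (fun y => H (x, y)) c d.

(** The counterclockwise contour integral: dw is dx on the horizontal sides and i dy on the vertical
    ones. *)
Definition rectint (H : C -> C) (a b c d : R) : C :=
  hint H a b c - hint H a b d + Ci * (vint H b c d - vint H a c d).

Definition rect (a b c d : R) (w : C) : Prop :=
  (a <= fst w <= b)%R /\ (c <= snd w <= d)%R.

Lemma Cmod_hor (x y t : R) : Cmod ((x, y) - (t, y)) = Rabs (x - t).
Proof.
  unfold Cmod, Cminus, Cplus, Copp; simpl.
  replace ((x + - t) * ((x + - t) * 1) + (y + - y) * ((y + - y) * 1))%R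
    with (Rsqr (x - t)) by (unfold Rsqr; ring).
  apply sqrt_Rsqr_abs.
Qed.

Lemma Cmod_ver (x y t : R) : Cmod ((x, y) - (x, t)) = Rabs (y - t).
Proof.
  unfold Cmod, Cminus, Cplus, Copp; simpl.
  replace ((x + - x) * ((x + - x) * 1) + (y + - t) * ((y + - t) * 1))%R
    with (Rsqr (y - t)) by (unfold Rsqr; ring).
  apply sqrt_Rsqr_abs.
Qed.

Lemma Cmod_le_sum (w : C) : (Cmod w <= Rabs (fst w) + Rabs (snd w))%R.
Proof.
  destruct w as [x y]. unfold Cmod; simpl.
  rewrite <- (sqrt_Rsqr (Rabs x + Rabs y))
    by (pose proof (Rabs_pos x); pose proof (Rabs_pos y); lra).
  apply sqrt_le_1_alt. unfold Rsqr.
  pose proof (Rabs_pos x); pose proof (Rabs_pos y).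
  pose proof (pow2_abs x). pose proof (pow2_abs y). nra.
Qed.

Lemma hor_continuous (H : C -> C) (x y : R) (l : C) : cdiff H (x, y) l ->
  continuous (U := C_R_NormedModule) (fun t => H (t, y)) x.
Proof.
  intros Hd. apply filterlim_locally. intros eps.
  destruct (cdiff_continuous _ _ _ Hd eps (cond_pos eps)) as [d [Hd0 Hc]].
  exists (mkposreal d Hd0). intros t Ht.
  apply C_NormedModule_mixin_compat1. apply Hc. rewrite Cmod_hor. exact Ht.
Qed.

Lemma ver_continuous (H : C -> C) (x y : R) (l : C) : cdiff H (x, y) l ->
  continuous (U := C_R_NormedModule) (fun t => H (x, t)) y.
Proof.
  intros Hd. apply filterlim_locally. intros eps.
  destruct (cdiff_continuous _ _ _ Hd eps (cond_pos eps)) as [d [Hd0 Hc]].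
  exists (mkposreal d Hd0). intros t Ht.
  apply C_NormedModule_mixin_compat1. apply Hc. rewrite Cmod_ver. exact Ht.
Qed.

Lemma hor_ex_RInt (H : C -> C) (a b y : R) : (a <= b)%R ->
  (forall x, (a <= x <= b)%R -> exists l, cdiff H (x, y) l) ->
  ex_RInt (V := C_R_CompleteNormedModule) (fun x => H (x, y)) a b.
Proof.
  intros Hab Hd. apply ex_RInt_continuous. intros x Hx.
  rewrite Rmin_left, Rmax_right in Hx by assumption.
  destruct (Hd x Hx) as [l Hl]. exact (hor_continuous _ _ _ _ Hl).
Qed.

Lemma ver_ex_RInt (H : C -> C) (x c d : R) : (c <= d)%R ->
  (forall y, (c <= y <= d)%R -> exists l, cdiff H (x, y) l) ->
  ex_RInt (V := C_R_CompleteNormedModule) (fun y => H (x, y)) c d.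
Proof.
  intros Hab Hd. apply ex_RInt_continuous. intros y Hy.
  rewrite Rmin_left, Rmax_right in Hy by assumption.
  destruct (Hd y Hy) as [l Hl]. exact (ver_continuous _ _ _ _ Hl).
Qed.

Lemma is_RInt_affine (p q a b : R) :
  is_RInt (fun x => p + q * x)%R a b (p * (b - a) + q * ((b ^ 2 - a ^ 2) / 2))%R.
Proof.
  replace (p * (b - a) + q * ((b ^ 2 - a ^ 2) / 2))%R with
    (minus ((fun x => p * x + q * (x ^ 2 / 2)) b)
           ((fun x => p * x + q * (x ^ 2 / 2)) a))%R
    by (unfold minus, plus, opp; simpl; field).
  apply (is_RInt_derive (V := R_CompleteNormedModule) (fun x => p * x + q * (x ^ 2 / 2))%R).
  - intros x _. auto_derive; [trivial|field].
  - intros x _. apply (continuous_plus (V := R_NormedModule)).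
    + apply continuous_const.
    + apply (continuous_mult (K := R_AbsRing)).
      * apply continuous_const.
      * apply continuous_id.
Qed.

Lemma hint_affine (A B : C) (a b y : R) :
  is_RInt (V := C_R_NormedModule) (fun x => A + B * (x, y)) a b
    (A * RtoC (b - a) + B * ((b ^ 2 - a ^ 2) / 2, y * (b - a))%R).
Proof.
  destruct A as [p q], B as [u v].
  apply (is_RInt_fct_extend_pair (U := R_NormedModule) (V := R_NormedModule)
    (fun x => (p, q) + (u, v) * (x, y))); simpl.
  - eapply is_RInt_ext; [|match goal with |- is_RInt _ _ _ ?l =>
      replace l with ((p - v * y) * (b - a) + u * ((b ^ 2 - a ^ 2) / 2))%R
       by (simpl; field) end; apply is_RInt_affine]. intros; simpl; ring.
  - eapply is_RInt_ext; [|match goal with |- is_RInt _ _ _ ?l =>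
      replace l with ((q + u * y) * (b - a) + v * ((b ^ 2 - a ^ 2) / 2))%R
       by (simpl; field) end; apply is_RInt_affine]. intros; simpl; ring.
Qed.

Lemma vint_affine (A B : C) (x c d : R) :
  is_RInt (V := C_R_NormedModule) (fun y => A + B * (x, y)) c d
    (A * RtoC (d - c) + B * (x * (d - c), (d ^ 2 - c ^ 2) / 2)%R).
Proof.
  destruct A as [p q], B as [u v].
  apply (is_RInt_fct_extend_pair (U := R_NormedModule) (V := R_NormedModule)
    (fun y => (p, q) + (u, v) * (x, y))); simpl.
  - eapply is_RInt_ext; [|match goal with |- is_RInt _ _ _ ?l =>
      replace l with ((p + u * x) * (d - c) + (- v) * ((d ^ 2 - c ^ 2) / 2))%R
       by (simpl; field) end; apply is_RInt_affine]. intros; simpl; ring.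
  - eapply is_RInt_ext; [|match goal with |- is_RInt _ _ _ ?l =>
      replace l with ((q + v * x) * (d - c) + u * ((d ^ 2 - c ^ 2) / 2))%R
       by (simpl; field) end; apply is_RInt_affine]. intros; simpl; ring.
Qed.

Lemma RInt_dist_le (f g : R -> C) (a b e : R) (l : C) : (a <= b)%R ->
  ex_RInt (V := C_R_CompleteNormedModule) f a b ->
  is_RInt (V := C_R_NormedModule) g a b l ->
  (forall x, (a <= x <= b)%R -> (Cmod (f x - g x) <= e)%R) ->
  (Cmod (RInt (V := C_R_CompleteNormedModule) f a b - l) <= (b - a) * e)%R.
Proof.
  intros Hab Hf Hg He.
  rewrite Cmod_norm.
  apply (norm_RInt_le_const (V := C_R_NormedModule) (fun x => minus (f x) (g x)) a b);
   [assumption| |].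
  - intros x Hx. specialize (He x Hx). rewrite Cmod_norm in He. exact He.
  - apply (is_RInt_minus (V := C_R_NormedModule)); [|assumption].
    exact (RInt_correct (V := C_R_CompleteNormedModule) _ _ _ Hf).
Qed.

(** The contour integral of an affine function is zero, so only the error survives: [e] times the
    perimeter. *)
Lemma rectint_near_affine (H : C -> C) (A B : C) (a b c d e : R) :
  (a <= b)%R -> (c <= d)%R ->
  (forall w, rect a b c d w -> exists l, cdiff H w l) ->
  (forall w, rect a b c d w -> (Cmod (H w - (A + B * w)) <= e)%R) ->
  (Cmod (rectint H a b c d) <= 2 * e * ((b - a) + (d - c)))%R.
Proof.
  intros Hab Hcd Hd He.
  assert (Hh : forall y, (c <= y <= d)%R ->
    (Cmod (hint H a b y - (A * RtoC (b - a) + B * ((b ^ 2 - a ^ 2) / 2, y * (b - a))%R))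
      <= (b - a) * e)%R).
  { intros y Hy. eapply RInt_dist_le; [assumption| |apply hint_affine|].
    - apply hor_ex_RInt; [assumption|]. intros x Hx. apply Hd. split; simpl; lra.
    - intros x Hx. apply He. split; simpl; lra. }
  assert (Hv : forall x, (a <= x <= b)%R ->
    (Cmod (vint H x c d - (A * RtoC (d - c) + B * (x * (d - c), (d ^ 2 - c ^ 2) / 2)%R))
      <= (d - c) * e)%R).
  { intros x Hx. eapply RInt_dist_le; [assumption| |apply vint_affine|].
    - apply ver_ex_RInt; [assumption|]. intros y Hy. apply Hd. split; simpl; lra.
    - intros y Hy. apply He. split; simpl; lra. }
  pose proof (Hh c ltac:(lra)) as H1. pose proof (Hh d ltac:(lra)) as H2.
  pose proof (Hv a ltac:(lra)) as H3. pose proof (Hv b ltac:(lra)) as H4.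
  match type of H1 with (Cmod ?u <= _)%R => set (u1 := u) in H1 end.
  match type of H2 with (Cmod ?u <= _)%R => set (u2 := u) in H2 end.
  match type of H3 with (Cmod ?u <= _)%R => set (u3 := u) in H3 end.
  match type of H4 with (Cmod ?u <= _)%R => set (u4 := u) in H4 end.
  (* Each [u] is the deviation of one side integral from its affine value; the four affine values
     cancel. *)
  replace (rectint H a b c d) with (u1 + - u2 + Ci * (u4 + - u3)).
  2:{ unfold u1, u2, u3, u4, rectint.
      destruct (hint H a b c), (hint H a b d), (vint H a c d), (vint H b c d), A, B.
      unfold Ci, RtoC, Cminus, Cplus, Copp, Cmult; simpl. f_equal; field. }
  eapply Rle_trans; [apply Cmod_triangle|].
  rewrite Cmod_mult, Cmod_Ci.
  pose proof (Cmod_triangle u1 (-u2)). pose proof (Cmod_triangle u4 (-u3)).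
  rewrite Cmod_opp in *. lra.
Qed.

Lemma rectint_split_x (H : C -> C) (a m b c d : R) : (a <= m <= b)%R -> (c <= d)%R ->
  (forall w, rect a b c d w -> exists l, cdiff H w l) ->
  rectint H a b c d = rectint H a m c d + rectint H m b c d.
Proof.
  intros Hm Hcd Hd. unfold rectint.
  assert (E : forall y, (c <= y <= d)%R -> hint H a b y = hint H a m y + hint H m b y).
  { intros y Hy. symmetry. apply (RInt_Chasles (V := C_R_CompleteNormedModule));
    apply hor_ex_RInt; try lra; intros x Hx; apply Hd; split; simpl; lra. }
  rewrite (E c), (E d) by lra. ring.
Qed.

Lemma rectint_split_y (H : C -> C) (a b c m d : R) : (a <= b)%R -> (c <= m <= d)%R ->
  (forall w, rect a b c d w -> exists l, cdiff H w l) ->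
  rectint H a b c d = rectint H a b c m + rectint H a b m d.
Proof.
  intros Hab Hm Hd. unfold rectint.
  assert (E : forall x, (a <= x <= b)%R -> vint H x c d = vint H x c m + vint H x m d).
  { intros x Hx. symmetry. apply (RInt_Chasles (V := C_R_CompleteNormedModule));
    apply ver_ex_RInt; try lra; intros y Hy; apply Hd; split; simpl; lra. }
  rewrite (E a), (E b) by lra. ring.
Qed.

(** The hypothesis says that left endpoints increase and right endpoints decrease, so the supremum
    of the left endpoints lies in every interval. *)
Lemma nested_limit (x : nat -> R) (L : R) : (0 <= L)%R ->
  (forall n, x n <= x (S n) /\ x (S n) + L / 2 ^ S n <= x n + L / 2 ^ n)%R ->
  exists r, forall n, (x n <= r <= x n + L / 2 ^ n)%R.
Proof.
  intros HL Hx.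
  assert (Hpos : forall n, (0 <= L / 2 ^ n)%R).
  { intros n. apply Rmult_le_pos; [assumption|].
    apply Rlt_le, Rinv_0_lt_compat, pow_lt; lra. }
  assert (Hlow : forall n k, (x n <= x (n + k)%nat)%R).
  { intros n k. induction k as [|k IH].
    - rewrite Nat.add_0_r. lra.
    - rewrite Nat.add_succ_r. destruct (Hx (n + k)%nat). lra. }
  assert (Hup : forall n k, (x (n + k)%nat + L / 2 ^ (n + k) <= x n + L / 2 ^ n)%R).
  { intros n k. induction k as [|k IH].
    - rewrite Nat.add_0_r. lra.
    - rewrite Nat.add_succ_r. destruct (Hx (n + k)%nat). lra. }
  assert (Hmn : forall m n, (x m <= x n + L / 2 ^ n)%R).
  { intros m n. destruct (Nat.le_ge_cases m n) as [Hle|Hle].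
    - replace n with (m + (n - m))%nat by lia.
      pose proof (Hlow m (n - m)%nat). specialize (Hpos (m + (n - m))%nat). lra.
    - replace m with (n + (m - n))%nat by lia.
      pose proof (Hup n (m - n)%nat). specialize (Hpos (n + (m - n))%nat). lra. }
  destruct (completeness (fun r => exists n, r = x n)) as [r [Hr1 Hr2]].
  - exists (x 0%nat + L / 2 ^ 0)%R. intros r [n ->]. apply Hmn.
  - exists (x 0%nat). now exists 0%nat.
  - exists r. intros n. split.
    + apply Hr1. now exists n.
    + apply Hr2. intros r' [m ->]. apply Hmn.
Qed.

Lemma quarter (a b c d : C) (m : R) : (m <= Cmod (a + b + (c + d)))%R ->
  (m / 4 <= Cmod a \/ m / 4 <= Cmod b \/ m / 4 <= Cmod c \/ m / 4 <= Cmod d)%R.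
Proof.
  intros H. pose proof (Cmod_triangle (a + b) (c + d)).
  pose proof (Cmod_triangle a b). pose proof (Cmod_triangle c d).
  destruct (Rle_dec (m / 4) (Cmod a)); [tauto|].
  destruct (Rle_dec (m / 4) (Cmod b)); [tauto|].
  destruct (Rle_dec (m / 4) (Cmod c)); [tauto|].
  destruct (Rle_dec (m / 4) (Cmod d)); [tauto|]. lra.
Qed.

Lemma bisect_step (H : C -> C) (x y L K m : R) : (0 <= L)%R -> (0 <= K)%R ->
  (forall w, rect x (x + L) y (y + K) w -> exists l, cdiff H w l) ->
  (m <= Cmod (rectint H x (x + L) y (y + K)))%R ->
  exists x' y', ((x' = x \/ x' = x + L / 2) /\ (y' = y \/ y' = y + K / 2))%R /\
   (m / 4 <= Cmod (rectint H x' (x' + L / 2) y' (y' + K / 2)))%R.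
Proof.
  intros HL HK Hd Hm.
  rewrite (rectint_split_x H x (x + L / 2) (x + L)) in Hm by (try assumption; lra).
  rewrite (rectint_split_y H x (x + L / 2) y (y + K / 2) (y + K)) in Hm;
    [|lra|lra|intros w [Hw1 Hw2]; apply Hd; split; lra].
  rewrite (rectint_split_y H (x + L / 2) (x + L) y (y + K / 2) (y + K)) in Hm;
    [|lra|lra|intros w [Hw1 Hw2]; apply Hd; split; lra].
  destruct (quarter _ _ _ _ _ Hm) as [Q|[Q|[Q|Q]]].
  - exists x, y. auto.
  - exists x, (y + K / 2)%R. replace (y + K / 2 + K / 2)%R with (y + K)%R by field. auto.
  - exists (x + L / 2)%R, y. replace (x + L / 2 + L / 2)%R with (x + L)%R by field. auto.
  - exists (x + L / 2)%R, (y + K / 2)%R.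
    replace (x + L / 2 + L / 2)%R with (x + L)%R by field.
    replace (y + K / 2 + K / 2)%R with (y + K)%R by field. auto.
Qed.

Lemma half_pow (L : R) (n : nat) : (L / 2 ^ S n = L / 2 ^ n / 2)%R.
Proof. simpl. field. apply pow_nonzero. lra. Qed.

(** Repeated quartering keeps a rectangle with integral at least M / 4^n. At the common limit point
    [H] is affine up to an error [e] times the distance, so the integral is also at most a constant
    times e / 4^n, and a small [e] contradicts M > 0. *)
Theorem goursat (H : C -> C) (a b c d : R) : (a <= b)%R -> (c <= d)%R ->
  (forall w, rect a b c d w -> exists l, cdiff H w l) ->
  rectint H a b c d = 0.
Proof.
  intros Hab Hcd Hd.
  set (L := (b - a)%R). set (K := (d - c)%R).
  assert (HL : (0 <= L)%R) by (unfold L; lra).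
  assert (HK : (0 <= K)%R) by (unfold K; lra).
  assert (Hp : forall n, (0 < 2 ^ n)%R) by (intros; apply pow_lt; lra).
  assert (HLn : forall n, (0 <= L / 2 ^ n)%R).
  { intros n. apply Rmult_le_pos; [assumption|]. apply Rlt_le, Rinv_0_lt_compat, Hp. }
  assert (HKn : forall n, (0 <= K / 2 ^ n)%R).
  { intros n. apply Rmult_le_pos; [assumption|]. apply Rlt_le, Rinv_0_lt_compat, Hp. }
  set (M := Cmod (rectint H a b c d)).
  pose (good := fun (n : nat) (q : R * R) =>
    (a <= fst q /\ fst q + L / 2 ^ n <= b /\ c <= snd q /\ snd q + K / 2 ^ n <= d /\
     M / 4 ^ n <= Cmod (rectint H (fst q) (fst q + L / 2 ^ n)
                                  (snd q) (snd q + K / 2 ^ n)))%R).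
  (* The existential stands before the hypothesis [good n q], so that choice gives a total function
     on corners; a corner that is not good is returned unchanged. *)
  assert (step : forall n q, exists q', good n q ->
    (good (S n) q' /\ (fst q' = fst q \/ fst q' = fst q + L / 2 ^ S n) /\
     (snd q' = snd q \/ snd q' = snd q + K / 2 ^ S n))%R).
  { intros n q. destruct (excluded_middle_informative (good n q)) as [Hg|Hg];
      [|exists q; tauto].
    destruct Hg as (g1 & g2 & g3 & g4 & g5).
    destruct (bisect_step H (fst q) (snd q) (L / 2 ^ n) (K / 2 ^ n) (M / 4 ^ n))
      as (x' & y' & [Hx Hy] & Hm); try apply HLn; try apply HKn; try assumption.
    { intros w [w1 w2]. apply Hd. split; lra. }
    exists (x', y'). intros _. unfold good; cbn [fst snd].
    rewrite !half_pow.
    replace (M / 4 ^ S n)%R with (M / 4 ^ n / 4)%R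
      by (simpl; field; apply pow_nonzero; lra).
    pose proof (HLn n). pose proof (HKn n).
    repeat split; try assumption; try (destruct Hx; lra); try (destruct Hy; lra). }
  pose (nxt := fun n q => proj1_sig (constructive_indefinite_description _ (step n q))).
  pose (q := fix q (n : nat) : R * R :=
    match n with O => (a, c) | S n => nxt n (q n) end).
  assert (Hq : forall n, good n (q n)).
  { induction n as [|n IH].
    - unfold good; simpl.
      replace (a + L / 1)%R with b by (unfold L; field).
      replace (c + K / 1)%R with d by (unfold K; field).
      unfold M. repeat split; lra.
    - apply (proj2_sig (constructive_indefinite_description _ (step n (q n))) IH). }
  assert (Hstep : forall n,
    ((fst (q (S n)) = fst (q n) \/ fst (q (S n)) = fst (q n) + L / 2 ^ S n) /\
     (snd (q (S n)) = snd (q n) \/ snd (q (S n)) = snd (q n) + K / 2 ^ S n))%R).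
  { intros n. exact (proj2 (proj2_sig
      (constructive_indefinite_description _ (step n (q n))) (Hq n))). }
  clearbody q.
  destruct (nested_limit (fun n => fst (q n)) L HL) as [x0 Hx0].
  { intros n. destruct (Hstep n) as [[E|E] _];
      rewrite E, half_pow; specialize (HLn n); lra. }
  destruct (nested_limit (fun n => snd (q n)) K HK) as [y0 Hy0].
  { intros n. destruct (Hstep n) as [_ [E|E]];
      rewrite E, half_pow; specialize (HKn n); lra. }
  cbv beta in Hx0, Hy0.
  assert (Hz : rect a b c d (x0, y0)).
  { destruct (Hq 0%nat) as (g1 & g2 & g3 & g4 & _).
    specialize (Hx0 0%nat). specialize (Hy0 0%nat). split; cbn [fst snd]; lra. }
  destruct (Hd _ Hz) as [l Hl].
  apply Cmod_eq_0. fold M.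
  apply Rle_antisym; [|apply Cmod_ge_0].
  apply Rnot_lt_le. intros HM.
  assert (HS : (0 < 1 + (L + K) ^ 2)%R) by nra.
  (* The final bound is M <= 2 e (L + K)^2, and this [e] makes the right side less than M / 2; the
     summand 1 covers a rectangle reduced to a point. *)
  destruct (Hl (M / (4 * (1 + (L + K) ^ 2)))%R) as [del [Hdel Hw]].
  { apply Rdiv_lt_0_compat; lra. }
  set (e := (M / (4 * (1 + (L + K) ^ 2)))%R) in *.
  assert (exists n, (L + K) / 2 ^ n < del)%R as [n Hn].
  { destruct (pow_lt_1_zero (/ 2) ltac:(rewrite Rabs_pos_eq; lra) (del / (1 + (L + K)))%R)
     as [n Hn]. { apply Rdiv_lt_0_compat; lra. }
    exists n. specialize (Hn n (le_n _)).
    rewrite Rabs_pos_eq in Hn by (apply pow_le; lra).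
    rewrite pow_inv in Hn.
    apply (Rmult_lt_compat_r (1 + (L + K))) in Hn; [|lra].
    unfold Rdiv in Hn at 1. rewrite Rmult_assoc, Rinv_l in Hn by lra.
    pose proof (Rinv_0_lt_compat _ (Hp n)). unfold Rdiv. nra. }
  destruct (Hq n) as (g1 & g2 & g3 & g4 & g5).
  (* Half the perimeter of the n-th rectangle, which also bounds its diameter. *)
  set (rn := ((L + K) / 2 ^ n)%R) in *.
  assert (Hrn : (L / 2 ^ n + K / 2 ^ n = rn)%R).
  { unfold rn; field. specialize (Hp n); lra. }
  assert (Hle : (M / 4 ^ n <= 2 * (e * rn) * rn)%R).
  { eapply Rle_trans; [apply g5|].
    eapply Rle_trans; [apply (rectint_near_affine H (H (x0, y0) - l * (x0, y0)) l)
      with (e := (e * rn)%R)|].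
    - specialize (HLn n); lra.
    - specialize (HKn n); lra.
    - intros w [w1 w2]. apply Hd. split; lra.
    - intros w [w1 w2].
      assert (Hwd : (Cmod (w - (x0, y0)) <= rn)%R).
      { eapply Rle_trans; [apply Cmod_le_sum|].
        specialize (Hx0 n). specialize (Hy0 n).
        rewrite <- Hrn. destruct w as [wx wy]. cbn in *.
        apply Rplus_le_compat; apply Rabs_le; lra. }
      replace (H w - (H (x0, y0) - l * (x0, y0) + l * w))
        with (H w - H (x0, y0) - l * (w - (x0, y0))) by ring.
      eapply Rle_trans; [apply Hw; lra|].
      apply Rmult_le_compat_l; [|assumption].
      apply Rlt_le, Rdiv_lt_0_compat; lra.
    - apply Req_le. rewrite <- Hrn. ring. }
  assert (E4 : (4 ^ n = 2 ^ n * 2 ^ n)%R)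
    by (rewrite <- Rpow_mult_distr; f_equal; ring).
  assert (Hle2 : (M <= 2 * e * (L + K) ^ 2)%R).
  { apply (Rmult_le_compat_r (4 ^ n)) in Hle; [|apply pow_le; lra].
    unfold Rdiv at 1 in Hle. rewrite Rmult_assoc, Rinv_l, Rmult_1_r in Hle
      by (apply pow_nonzero; lra).
    eapply Rle_trans; [apply Hle|]. rewrite E4. unfold rn.
    apply Req_le. field. specialize (Hp n); lra. }
  assert (He : (e * (4 * (1 + (L + K) ^ 2)) = M)%R) by (unfold e; field; lra).
  assert (0 < e)%R by (apply Rdiv_lt_0_compat; lra).
  nra.
Qed.

(** * Complex derivatives and the mean value property *)

(** Imports the rules for sums, products and compositions; the inverse and the exponential are
    estimated directly. *)
Lemma cdiff_is_derive (h : C -> C) (z l : C) :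
  cdiff h z l <->
  is_derive (K := C_AbsRing) (V := AbsRing_NormedModule C_AbsRing) h z l.
Proof.
  split.
  - intros Hh. split; [apply is_linear_scal_l|].
    intros x Hx.
    apply (is_filter_lim_locally_unique (V := AbsRing_NormedModule C_AbsRing)) in Hx.
    subst x. intros eps. destruct (Hh eps (cond_pos eps)) as [d [Hd H]].
    exists (mkposreal d Hd). intros y Hy.
    specialize (H y Hy).
    replace (h y - h z - l * (y - z)) with (h y - h z - (y - z) * l) in H by ring. exact H.
  - intros [_ Hh] eps Heps.
    destruct (Hh z (fun P H => H) (mkposreal eps Heps)) as [d Hd].
    exists d. split; [apply cond_pos|]. intros w Hw.
    replace (h w - h z - l * (w - z)) with (h w - h z - (w - z) * l) by ring.
    exact (Hd w Hw).
Qed.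

Lemma cdiff_const (a z : C) : cdiff (fun _ => a) z 0.
Proof.
  apply cdiff_is_derive.
  apply (is_derive_const (K := C_AbsRing) (V := AbsRing_NormedModule C_AbsRing)).
Qed.

Lemma cdiff_id (z : C) : cdiff (fun w => w) z 1.
Proof. apply cdiff_is_derive. apply (is_derive_id (K := C_AbsRing)). Qed.

Lemma cdiff_plus (f g : C -> C) (z l m : C) : cdiff f z l -> cdiff g z m ->
  cdiff (fun w => f w + g w) z (l + m).
Proof.
  rewrite !cdiff_is_derive.
  apply (is_derive_plus (K := C_AbsRing) (V := AbsRing_NormedModule C_AbsRing)).
Qed.

Lemma cdiff_mult (f g : C -> C) (z l m : C) : cdiff f z l -> cdiff g z m ->
  cdiff (fun w => f w * g w) z (l * g z + f z * m).
Proof.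
  rewrite !cdiff_is_derive. intros Hf Hg.
  apply (is_derive_mult (K := C_AbsRing) f g z l m Hf Hg Cmult_comm).
Qed.

Lemma cdiff_comp (f g : C -> C) (z l m : C) : cdiff f (g z) l -> cdiff g z m ->
  cdiff (fun w => f (g w)) z (l * m).
Proof.
  rewrite !cdiff_is_derive, (Cmult_comm l m).
  apply (is_derive_comp (K := C_AbsRing) (V := AbsRing_NormedModule C_AbsRing)).
Qed.

(** The remainder is exactly (w - z)^2 / (w z^2), and |w| >= |z| / 2 near z. *)
Lemma cdiff_inv (z : C) : z <> 0 -> cdiff Cinv z (- / (z * z)).
Proof.
  intros Hz eps Heps.
  pose proof (proj1 (Cmod_gt_0 z) Hz) as Hm.
  set (m := Cmod z) in *.
  assert (Hd : (0 < Rmin (m / 2) (eps * m ^ 3 / 2))%R).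
  { apply Rmin_pos; [lra|]. apply Rdiv_lt_0_compat; [|lra].
    apply Rmult_lt_0_compat; [assumption|now apply pow_lt]. }
  exists (Rmin (m / 2) (eps * m ^ 3 / 2))%R. split; [assumption|].
  intros w Hw.
  pose proof (Rlt_le_trans _ _ _ Hw (Rmin_l _ _)) as H1.
  pose proof (Rlt_le_trans _ _ _ Hw (Rmin_r _ _)) as H2.
  assert (Hwm : (m / 2 <= Cmod w)%R).
  { pose proof (Cmod_triangle w (- (w - z))) as T. rewrite Cmod_opp in T.
    replace (w + - (w - z)) with z in T by ring. fold m in T. lra. }
  assert (Hw0 : w <> 0) by (apply Cmod_gt_0; lra).
  replace (/ w - / z - - / (z * z) * (w - z))
    with ((w - z) * (w - z) * / (w * (z * z))) by (field; auto).
  rewrite !Cmod_mult, Cmod_inv, !Cmod_mult by (repeat apply Cmult_neq_0; assumption).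
  fold m. set (t := Cmod (w - z)) in *. assert (0 <= t)%R by apply Cmod_ge_0.
  assert (HP : (0 < Cmod w * (m * m))%R) by (repeat apply Rmult_lt_0_compat; lra).
  apply Rmult_le_reg_r with (Cmod w * (m * m))%R; [assumption|].
  rewrite Rmult_assoc, Rinv_l, Rmult_1_r by lra.
  assert (t <= eps * (m * m) * Cmod w)%R; [|nra].
  apply Rle_trans with (eps * (m * m) * (m / 2))%R; [nra|].
  apply Rmult_le_compat_l; [|assumption]. nra.
Qed.

(** * The complex exponential *)

Definition cexp (w : C) : C :=
  (exp (fst w) * cos (snd w), exp (fst w) * sin (snd w))%R.

Lemma cexp_plus (z w : C) : cexp (z + w) = cexp z * cexp w.
Proof.
  destruct z as [a b], w as [c d]. unfold cexp, Cplus, Cmult; cbn [fst snd].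
  rewrite exp_plus, cos_plus, sin_plus. f_equal; ring.
Qed.

Lemma Cmod_cexp (w : C) : Cmod (cexp w) = exp (fst w).
Proof.
  destruct w as [a b]. unfold cexp, Cmod; cbn [fst snd].
  replace ((exp a * cos b) ^ 2 + (exp a * sin b) ^ 2)%R with (Rsqr (exp a)).
  - apply sqrt_Rsqr. apply Rlt_le, exp_pos.
  - pose proof (sin2_cos2 b). unfold Rsqr in *. nra.
Qed.

Lemma derivable_at_0 (f : R -> R) (l : R) : derivable_pt_lim f 0 l ->
  forall eps, (0 < eps)%R -> exists d, (0 < d)%R /\
    forall h, (Rabs h < d)%R -> (Rabs (f h - f 0 - l * h) <= eps * Rabs h)%R.
Proof.
  intros Hf eps Heps. destruct (Hf eps Heps) as [d Hd].
  exists d. split; [apply cond_pos|]. intros h Hh.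
  destruct (Req_dec h 0) as [->|H0].
  - rewrite Rmult_0_r, !Rminus_diag, Rabs_R0. lra.
  - specialize (Hd h H0 Hh). rewrite Rplus_0_l in Hd.
    replace (f h - f 0 - l * h)%R with (((f h - f 0) / h - l) * h)%R by (now field).
    rewrite Rabs_mult. apply Rmult_le_compat_r; [apply Rabs_pos|lra].
Qed.

(** The addition formula reduces the claim to the origin, where it follows from the first-order
    expansions of the real exp, cos and sin. *)
Lemma cdiff_cexp (z : C) : cdiff cexp z (cexp z).
Proof.
  assert (H0 : forall eps, (0 < eps)%R -> exists d, (0 < d)%R /\
    forall w, (Cmod w < d)%R -> (Cmod (cexp w - 1 - w) <= eps * Cmod w)%R).
  { intros eps Heps.
    (* The real and the imaginary remainder are each at most 3 e t, whence the 6; e <= 1 and t < e /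
       2 give |exp x - 1| <= e and exp x <= 2. *)
    set (e := Rmin 1 (eps / 6)). assert (He : (0 < e)%R) by (apply Rmin_pos; lra).
    assert (He1 : (e <= 1)%R) by apply Rmin_l.
    assert (He2 : (e <= eps / 6)%R) by apply Rmin_r.
    destruct (derivable_at_0 exp _ (derivable_pt_lim_exp 0) e He) as [d1 [D1 E1]].
    destruct (derivable_at_0 cos _ (derivable_pt_lim_cos 0) e He) as [d2 [D2 E2]].
    destruct (derivable_at_0 sin _ (derivable_pt_lim_sin 0) e He) as [d3 [D3 E3]].
    rewrite exp_0 in E1. rewrite cos_0, sin_0 in E2. rewrite sin_0, cos_0 in E3.
    exists (Rmin (e / 2) (Rmin d1 (Rmin d2 d3))). split.
    { repeat apply Rmin_pos; lra. }
    intros [x y] Hw.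
    pose proof (Rmax_Cmod (x, y)) as Hm. cbn [fst snd] in Hm.
    set (t := Cmod (x, y)) in *.
    pose proof (Rle_trans _ _ _ (Rmax_l _ _) Hm) as Hx.
    pose proof (Rle_trans _ _ _ (Rmax_r _ _) Hm) as Hy.
    apply Rmin_Rgt_l in Hw. destruct Hw as [W0 Hw].
    apply Rmin_Rgt_l in Hw. destruct Hw as [W1 Hw].
    apply Rmin_Rgt_l in Hw. destruct Hw as [W2 W3].
    specialize (E1 x ltac:(lra)). specialize (E2 y ltac:(lra)). specialize (E3 y ltac:(lra)).
    pose proof (Rabs_pos x) as Px. pose proof (Rabs_pos y) as Py.
    assert (A1 : (Rabs (exp x - 1 - x) <= e * t)%R)
      by (rewrite Rmult_1_l in E1; nra).
    assert (A2 : (Rabs (cos y - 1) <= e * t)%R).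
    { replace (cos y - 1)%R with (cos y - 1 - - 0 * y)%R by ring. nra. }
    assert (A3 : (Rabs (sin y - y) <= e * t)%R).
    { replace (sin y - y)%R with (sin y - 0 - 1 * y)%R by ring. nra. }
    assert (A4 : (Rabs (exp x - 1) <= e)%R).
    { replace (exp x - 1)%R with ((exp x - 1 - x) + x)%R by ring.
      eapply Rle_trans; [apply Rabs_triang|]. nra. }
    assert (A5 : (Rabs (exp x) <= 2)%R).
    { replace (exp x) with ((exp x - 1) + 1)%R by ring.
      eapply Rle_trans; [apply Rabs_triang|]. rewrite Rabs_R1. lra. }
    eapply Rle_trans; [apply Cmod_le_sum|].
    unfold cexp, RtoC, Cminus, Cplus, Copp; cbn [fst snd].
    replace (exp x * cos y + - (1) + - x)%R
      with ((exp x - 1 - x) + exp x * (cos y - 1))%R by ring.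
    replace (exp x * sin y + - 0 + - y)%R
      with (exp x * (sin y - y) + (exp x - 1) * y)%R by ring.
    pose proof (Rabs_triang (exp x - 1 - x) (exp x * (cos y - 1))) as T1.
    pose proof (Rabs_triang (exp x * (sin y - y)) ((exp x - 1) * y)) as T2.
    rewrite Rabs_mult in T1. rewrite 2!Rabs_mult in T2.
    assert (0 <= t)%R by lra.
    pose proof (Rabs_pos (exp x)). pose proof (Rabs_pos (cos y - 1)).
    pose proof (Rabs_pos (sin y - y)). pose proof (Rabs_pos (exp x - 1)).
    assert (Rabs (exp x) * Rabs (cos y - 1) <= 2 * (e * t))%R
      by (apply Rmult_le_compat; lra).
    assert (Rabs (exp x) * Rabs (sin y - y) <= 2 * (e * t))%R
      by (apply Rmult_le_compat; lra).
    assert (Rabs (exp x - 1) * Rabs y <= e * t)%R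
      by (apply Rmult_le_compat; lra).
    assert (e * t <= eps / 6 * t)%R by (apply Rmult_le_compat_r; lra).
    lra. }
  intros eps Heps.
  assert (Hz : (0 < Cmod (cexp z))%R) by (rewrite Cmod_cexp; apply exp_pos).
  destruct (H0 (eps / Cmod (cexp z))%R) as [d [Hd H]].
  { apply Rdiv_lt_0_compat; assumption. }
  exists d. split; [assumption|]. intros w Hw. specialize (H _ Hw).
  replace (cexp w - cexp z - cexp z * (w - z))
    with (cexp z * (cexp (w - z) - 1 - (w - z))).
  2:{ replace (cexp w) with (cexp z * cexp (w - z)); [ring|].
      rewrite <- cexp_plus. f_equal. ring. }
  rewrite Cmod_mult. apply (Rmult_le_compat_l (Cmod (cexp z))) in H; [|lra].
  eapply Rle_trans; [exact H|]. apply Req_le. field. lra.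
Qed.

(** * Differentiability in two complex variables and the chain rule along a disc *)

Definition prod_diff (f : C * C -> C) (x : C * C) (l1 l2 : C) : Prop :=
  forall eps : R, (0 < eps)%R -> exists delta : R, (0 < delta)%R /\
    forall y : C * C,
      (Cmod (fst y - fst x) < delta)%R -> (Cmod (snd y - snd x) < delta)%R ->
      (Cmod (f y - f x - (l1 * (fst y - fst x) + l2 * (snd y - snd x)))
       <= eps * (Cmod (fst y - fst x) + Cmod (snd y - snd x)))%R.

(** By C-linearity the differential is determined by its values on the two basis vectors, and the
    Euclidean norm of the product is at most the sum of the moduli. *)
Lemma ex_filterdiff_prod_diff (f : C * C -> C) (x : C * C) :
  ex_filterdiff (K := C_AbsRing)
    (U := prod_NormedModule C_AbsRing C_NormedModule C_NormedModule)
    (V := C_NormedModule) f (locally x) ->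
  exists l1 l2, prod_diff f x l1 l2.
Proof.
  intros [l [[Hp Hs _] Hd]].
  exists (l (RtoC 1, RtoC 0)), (l (RtoC 0, RtoC 1)). intros eps Heps.
  destruct (Hd x (fun P H => H) (mkposreal eps Heps)) as [d H].
  exists d. split; [apply cond_pos|]. intros y H1 H2.
  assert (Hl : l (minus y x) =
    l (RtoC 1, RtoC 0) * (fst y - fst x) + l (RtoC 0, RtoC 1) * (snd y - snd x)).
  { transitivity (l (plus (scal (fst y - fst x : C_AbsRing) (RtoC 1, RtoC 0))
                          (scal (snd y - snd x : C_AbsRing) (RtoC 0, RtoC 1)))).
    - f_equal. destruct y as [y1 y2], x as [x1 x2].
      change ((y1 - x1, y2 - x2) =
        ((y1 - x1) * 1 + (y2 - x2) * 0, (y1 - x1) * 0 + (y2 - x2) * 1)).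
      f_equal; ring.
    - rewrite Hp, !Hs.
      change ((fst y - fst x) * l (RtoC 1, RtoC 0) + (snd y - snd x) * l (RtoC 0, RtoC 1) =
        l (RtoC 1, RtoC 0) * (fst y - fst x) + l (RtoC 0, RtoC 1) * (snd y - snd x)). ring. }
  assert (Hb : ball x d y).
  { split; apply C_NormedModule_mixin_compat1; assumption. }
  assert (H' : (Cmod (f y - f x - l (minus y x)) <=
    eps * sqrt (Cmod (fst y - fst x) ^ 2 + Cmod (snd y - snd x) ^ 2))%R) by exact (H y Hb).
  rewrite Hl in H'.
  eapply Rle_trans; [exact H'|]. apply Rmult_le_compat_l; [simpl; lra|].
  pose proof (Cmod_le_sum (Cmod (fst y - fst x), Cmod (snd y - snd x))) as T.
  unfold Cmod at 1 in T. cbn [fst snd] in T.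
  rewrite !Rabs_pos_eq in T by apply Cmod_ge_0. exact T.
Qed.

Lemma cdiff_lipschitz (h : C -> C) (z l : C) : cdiff h z l ->
  exists d, (0 < d)%R /\ forall w, (Cmod (w - z) < d)%R ->
    (Cmod (h w - h z) <= (Cmod l + 1) * Cmod (w - z))%R.
Proof.
  intros Hh. destruct (Hh 1%R Rlt_0_1) as [d [Hd H]]. exists d. split; [assumption|].
  intros w Hw. specialize (H w Hw).
  replace (h w - h z) with ((h w - h z - l * (w - z)) + l * (w - z)) by ring.
  eapply Rle_trans; [apply Cmod_triangle|]. rewrite Cmod_mult. lra.
Qed.

Lemma cdiff_prod_comp (f : C * C -> C) (u v : C -> C) (z l1 l2 a b : C) :
  prod_diff f (u z, v z) l1 l2 -> cdiff u z a -> cdiff v z b ->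
  cdiff (fun w => f (u w, v w)) z (l1 * a + l2 * b).
Proof.
  intros Hf Hu Hv eps Heps.
  pose proof (Cmod_ge_0 a) as Pa. pose proof (Cmod_ge_0 b) as Pb.
  pose proof (Cmod_ge_0 l1) as P1. pose proof (Cmod_ge_0 l2) as P2.
  (* [k] adds the local Lipschitz constants |a| + 1 and |b| + 1 of [u] and [v]; with [m] above |l1|
     + |l2|, the remainder of [f] and those of [u] and [v] take half of [eps] each. *)
  set (k := (Cmod a + Cmod b + 2)%R). assert (Hk : (0 < k)%R) by (unfold k; lra).
  set (m := (Cmod l1 + Cmod l2 + 1)%R). assert (Hm : (0 < m)%R) by (unfold m; lra).
  destruct (Hf (eps / 2 / k)%R) as [d0 [D0 E0]]; [repeat apply Rdiv_lt_0_compat; lra|].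
  destruct (Hu (eps / 2 / m)%R) as [d1 [D1 E1]]; [repeat apply Rdiv_lt_0_compat; lra|].
  destruct (Hv (eps / 2 / m)%R) as [d2 [D2 E2]]; [repeat apply Rdiv_lt_0_compat; lra|].
  destruct (cdiff_lipschitz _ _ _ Hu) as [d3 [D3 E3]].
  destruct (cdiff_lipschitz _ _ _ Hv) as [d4 [D4 E4]].
  destruct (cdiff_continuous _ _ _ Hu d0 D0) as [d5 [D5 E5]].
  destruct (cdiff_continuous _ _ _ Hv d0 D0) as [d6 [D6 E6]].
  exists (Rmin d1 (Rmin d2 (Rmin d3 (Rmin d4 (Rmin d5 d6))))). split.
  { repeat apply Rmin_pos; assumption. }
  intros w Hw.
  apply Rmin_Rgt_l in Hw; destruct Hw as [W1 Hw].
  apply Rmin_Rgt_l in Hw; destruct Hw as [W2 Hw].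
  apply Rmin_Rgt_l in Hw; destruct Hw as [W3 Hw].
  apply Rmin_Rgt_l in Hw; destruct Hw as [W4 Hw].
  apply Rmin_Rgt_l in Hw; destruct Hw as [W5 W6].
  specialize (E0 (u w, v w) (E5 w W5) (E6 w W6)). cbn [fst snd] in E0.
  specialize (E1 w W1). specialize (E2 w W2). specialize (E3 w W3). specialize (E4 w W4).
  set (t := Cmod (w - z)) in *. assert (Ht : (0 <= t)%R) by apply Cmod_ge_0.
  match goal with |- (Cmod ?x <= _)%R => replace x with
   ((f (u w, v w) - f (u z, v z) - (l1 * (u w - u z) + l2 * (v w - v z)))
    + (l1 * (u w - u z - a * (w - z)) + l2 * (v w - v z - b * (w - z)))) by ring end.
  eapply Rle_trans; [apply Cmod_triangle|].
  pose proof (Cmod_triangle (l1 * (u w - u z - a * (w - z)))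
    (l2 * (v w - v z - b * (w - z)))) as T. rewrite !Cmod_mult in T.
  assert (X0 : (eps / 2 / k * (Cmod (u w - u z) + Cmod (v w - v z)) <= eps / 2 * t)%R).
  { apply Rle_trans with (eps / 2 / k * (k * t))%R.
    - apply Rmult_le_compat_l; [apply Rlt_le; repeat apply Rdiv_lt_0_compat; lra|].
      unfold k. lra.
    - apply Req_le. field. lra. }
  assert (X1 : (Cmod l1 * Cmod (u w - u z - a * (w - z))
     + Cmod l2 * Cmod (v w - v z - b * (w - z)) <= eps / 2 * t)%R).
  { assert (0 < eps / 2 / m)%R by (repeat apply Rdiv_lt_0_compat; lra).
    apply Rle_trans with (eps / 2 / m * (m * t))%R.
    - apply Rle_trans with ((Cmod l1 + Cmod l2) * (eps / 2 / m * t))%R.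
      + rewrite Rmult_plus_distr_r. apply Rplus_le_compat; apply Rmult_le_compat_l; assumption.
      + unfold m in *. assert (0 <= eps / 2 / (Cmod l1 + Cmod l2 + 1) * t)%R
          by (apply Rmult_le_pos; lra). nra.
    - apply Req_le. field. lra. }
  lra.
Qed.

(** In the coordinate w = log z the punctured disc is the left half-plane, circles are segments of
    height 2 pi, and the centre, with value [h0], lies at real part minus infinity. The mean over a
    segment is close to [h0] far to the left and bounded by nearly [M] close to the imaginary
    axis. *)
Lemma Cmod_le_of_vertical_means (H : C -> C) (h0 : C) (M : R) :
  (forall w, (fst w < 0)%R -> exists l, cdiff H w l) ->
  (forall x, H (x, 2 * PI)%R = H (x, 0%R)) ->
  (forall eps, (0 < eps)%R -> exists X, forall x y, (x <= X)%R ->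
    (Cmod (H (x, y) - h0) <= eps)%R) ->
  (forall eps, (0 < eps)%R -> exists d, (0 < d)%R /\ forall x y, (- d < x < 0)%R ->
    (0 <= y <= 2 * PI)%R -> (Cmod (H (x, y)) <= M + eps)%R) ->
  (Cmod h0 <= M)%R.
Proof.
  intros Hd Hper Hlim Hbd.
  apply le_epsilon. intros eps Heps.
  destruct (Hlim (eps / 2)%R) as [X HX]; [lra|].
  destruct (Hbd (eps / 2)%R) as [d [Hd0 Hb]]; [lra|].
  (* [b] lies in the strip where the boundary bound holds, [a] far enough left for the limit. *)
  set (b := (- d / 2)%R). set (a := Rmin X b).
  assert (Hab : (a <= b)%R) by apply Rmin_r.
  assert (HaX : (a <= X)%R) by apply Rmin_l.
  assert (Hb0 : (b < 0)%R) by (unfold b; lra).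
  pose proof PI_RGT_0 as HPI.
  assert (HG : rectint H a b 0 (2 * PI) = 0).
  { apply goursat; [assumption|lra|]. intros w [Hw _]. apply Hd. lra. }
  assert (Eh : hint H a b 0 = hint H a b (2 * PI)).
  { apply (RInt_ext (V := C_R_CompleteNormedModule)). intros x _. symmetry. apply Hper. }
  (* With the horizontal sides cancelled, only [Ci] times the difference is left; multiplying by
     [- Ci] removes the factor. *)
  assert (Ev : vint H b 0 (2 * PI) = vint H a 0 (2 * PI)).
  { unfold rectint in HG. rewrite Eh in HG.
    assert (HC : Ci * (vint H b 0 (2 * PI) - vint H a 0 (2 * PI)) = 0)
      by (rewrite <- HG; ring).
    assert (HC2 : vint H b 0 (2 * PI) - vint H a 0 (2 * PI) =
      - Ci * (Ci * (vint H b 0 (2 * PI) - vint H a 0 (2 * PI)))).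
    { destruct (vint H b 0 (2 * PI)), (vint H a 0 (2 * PI)).
      unfold Ci, Cminus, Cplus, Copp, Cmult; cbn [fst snd]. f_equal; ring. }
    rewrite HC, Cmult_0_r in HC2.
    replace (vint H b 0 (2 * PI)) with
      (vint H b 0 (2 * PI) - vint H a 0 (2 * PI) + vint H a 0 (2 * PI)) by ring.
    rewrite HC2. ring. }
  (* Comparison with the constants [h0] here and 0 below, taken as affine functions of slope 0 so
     that [vint_affine] evaluates them. *)
  assert (Ca : (Cmod (vint H a 0 (2 * PI) - (h0 * RtoC (2 * PI - 0)
     + 0 * (a * (2 * PI - 0), ((2 * PI) ^ 2 - 0 ^ 2) / 2)%R)) <= (2 * PI - 0) * (eps / 2))%R).
  { eapply RInt_dist_le; [lra| |apply vint_affine|].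
    - apply ver_ex_RInt; [lra|]. intros y _. apply Hd. simpl; lra.
    - intros y _. cbv beta. replace (h0 + 0 * (a, y)) with h0 by ring. apply HX. assumption. }
  assert (Cb : (Cmod (vint H b 0 (2 * PI) - (0 * RtoC (2 * PI - 0)
     + 0 * (b * (2 * PI - 0), ((2 * PI) ^ 2 - 0 ^ 2) / 2)%R)) <= (2 * PI - 0) * (M + eps / 2))%R).
  { eapply RInt_dist_le; [lra| |apply vint_affine|].
    - apply ver_ex_RInt; [lra|]. intros y _. apply Hd. simpl; lra.
    - intros y Hy. cbv beta. replace (H (b, y) - (0 + 0 * (b, y))) with (H (b, y)) by ring.
      apply Hb; [unfold b; lra|assumption]. }
  rewrite Ev in Cb. rewrite Rminus_0_r in *.
  set (V := vint H a 0 (2 * PI)) in *.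
  rewrite Cmult_0_l, Cplus_0_r in Ca. rewrite !Cmult_0_l in Cb.
  replace (V - (0 + 0)) with V in Cb by ring.
  pose proof (Cmod_triangle V (- (V - h0 * RtoC (2 * PI)))) as T.
  replace (V + - (V - h0 * RtoC (2 * PI))) with (h0 * RtoC (2 * PI)) in T by ring.
  rewrite Cmod_opp, Cmod_mult, Cmod_R, (Rabs_pos_eq (2 * PI)) in T by lra.
  apply Rmult_le_reg_r with (2 * PI)%R; [lra|].
  eapply Rle_trans; [exact T|]. nra.
Qed.

(** * The symmetrized bidisc and the image of the torus *)

(** The parts of the root solve a^2 + b^2 = |z| and a^2 - b^2 = x; the sign of [y] then decides the
    sign of b. *)
Lemma Csqrt_exists (z : C) : exists w : C, w * w = z.
Proof.
  destruct z as [x y].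
  set (r := Cmod (x, y)).
  assert (Hr0 : (0 <= r)%R) by apply Cmod_ge_0.
  assert (Hr : (r * r = x ^ 2 + y ^ 2)%R).
  { unfold r, Cmod; cbn [fst snd]. apply sqrt_sqrt. nra. }
  assert (Hx : (- r <= x <= r)%R) by nra.
  assert (Ha := sqrt_sqrt ((r + x) / 2) ltac:(lra)).
  assert (Hb := sqrt_sqrt ((r - x) / 2) ltac:(lra)).
  pose proof (sqrt_pos ((r + x) / 2)) as Pa. pose proof (sqrt_pos ((r - x) / 2)) as Pb.
  set (a := sqrt ((r + x) / 2)) in *. set (b := sqrt ((r - x) / 2)) in *.
  assert (Hab : ((2 * (a * b)) ^ 2 = y ^ 2)%R).
  { replace ((2 * (a * b)) ^ 2)%R with (4 * (a * a) * (b * b))%R by ring.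
    rewrite Ha, Hb. nra. }
  assert (0 <= a * b)%R by (apply Rmult_le_pos; assumption).
  destruct (Rle_dec 0 y) as [Hy|Hy].
  - exists (a, b). unfold Cmult; cbn [fst snd].
    assert (2 * (a * b) = y)%R by nra. f_equal; lra.
  - exists (a, - b)%R. unfold Cmult; cbn [fst snd].
    assert (2 * (a * b) = - y)%R by nra. f_equal; lra.
Qed.

(** Every point of C^2 is a symmetrized pair, so membership in [Gamma] becomes a bound on the
    roots. *)
Lemma quadratic_roots (s p : C) : exists z1 z2 : C, s = z1 + z2 /\ p = z1 * z2.
Proof.
  destruct (Csqrt_exists (s * s - 4 * p)) as [d Hd].
  exists ((s + d) / 2), ((s - d) / 2). split; [field|].
  replace ((s + d) / 2 * ((s - d) / 2)) with ((s * s - d * d) / 4)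
   by (field).
  rewrite Hd. field.
Qed.

Lemma sym_defect (z1 z2 : C) :
  (z1 + z2) - Cconj (z1 + z2) * (z1 * z2) =
  z1 * RtoC (1 - Cmod z2 ^ 2) + z2 * RtoC (1 - Cmod z1 ^ 2).
Proof.
  rewrite !RtoC_minus, !Cmod2_conj.
  destruct z1 as [a b], z2 as [c d].
  unfold Cconj, Cminus, Cplus, Copp, Cmult, RtoC; cbn [fst snd]. f_equal; ring.
Qed.

Lemma Cmod_mult_RtoC (z : C) (r : R) : (0 <= r)%R -> Cmod (z * RtoC r) = (Cmod z * r)%R.
Proof. intros Hr. now rewrite Cmod_mult, Cmod_R, Rabs_pos_eq. Qed.

(** With a, b the moduli, a (1 - b^2) + b (1 - a^2) = (a + b) (1 - a b). *)
Lemma sym_defect_le (z1 z2 : C) : (Cmod z1 <= 1)%R -> (Cmod z2 <= 1)%R ->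
  (Cmod ((z1 + z2) - Cconj (z1 + z2) * (z1 * z2)) <=
    (Cmod z1 + Cmod z2) * (1 - Cmod (z1 * z2)))%R.
Proof.
  intros H1 H2. rewrite sym_defect, Cmod_mult.
  pose proof (Cmod_ge_0 z1). pose proof (Cmod_ge_0 z2).
  eapply Rle_trans; [apply Cmod_triangle|].
  rewrite !Cmod_mult_RtoC by nra. nra.
Qed.

(* If exactly one root leaves the disc, [a = |z1| > 1 > b = |z2|], the defect
   is at least [(a + b) (1 - a b)], which exceeds [1 - (a b)^2]. *)
Lemma root_in_disc (z1 z2 : C) : (Cmod (z1 * z2) < 1)%R ->
  (Cmod ((z1 + z2) - Cconj (z1 + z2) * (z1 * z2)) + Cmod (z1 * z2) ^ 2 <= 1)%R ->
  (Cmod z1 <= 1)%R.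
Proof.
  rewrite sym_defect, Cmod_mult. intros Hp H.
  apply Rnot_lt_le. intros Ha.
  pose proof (Cmod_ge_0 z2) as Hb0.
  set (a := Cmod z1) in *. set (b := Cmod z2) in *.
  assert (Hb : (b < 1)%R) by nra.
  (* Reverse triangle inequality: cancelling the second term leaves z1 (1 - b^2), of modulus a (1 -
     b^2). *)
  pose proof (Cmod_triangle (z1 * RtoC (1 - b ^ 2) + z2 * RtoC (1 - a ^ 2))
    (z2 * RtoC (a ^ 2 - 1))) as T.
  replace (z1 * RtoC (1 - b ^ 2) + z2 * RtoC (1 - a ^ 2) + z2 * RtoC (a ^ 2 - 1))
    with (z1 * RtoC (1 - b ^ 2)) in T by (rewrite !RtoC_minus; ring).
  assert (Qa : (0 <= a ^ 2 - 1)%R) by nra. assert (Qb : (0 <= 1 - b ^ 2)%R) by nra.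
  rewrite !Cmod_mult_RtoC in T by assumption. fold a b in T.
  match type of H with (?x + _ <= _)%R =>
    assert (D : ((a + b) * (1 - a * b) <= x)%R) by nra end.
  assert (0 < (1 - a * b) * ((a - 1) * (1 - b)))%R
    by (repeat apply Rmult_lt_0_compat; lra).
  nra.
Qed.

Lemma Gamma_of_defect (s p : C) : (Cmod p < 1)%R ->
  (Cmod (s - Cconj s * p) + Cmod p ^ 2 <= 1)%R -> Gamma (s, p).
Proof.
  destruct (quadratic_roots s p) as (z1 & z2 & -> & ->). intros Hp H.
  exists z1, z2. split; [|split; [|reflexivity]].
  - exact (root_in_disc z1 z2 Hp H).
  - apply (root_in_disc z2 z1).
    + now rewrite Cmult_comm.
    + now rewrite Cplus_comm, (Cmult_comm z2 z1).
Qed.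

Lemma Gamma_defect (s p : C) : Gamma (s, p) ->
  (Cmod (s - Cconj s * p) + Cmod p ^ 2 <= 1)%R.
Proof.
  intros (z1 & z2 & H1 & H2 & E). injection E as -> ->.
  pose proof (sym_defect_le z1 z2 H1 H2) as H. rewrite Cmod_mult in *.
  pose proof (Cmod_ge_0 z1). pose proof (Cmod_ge_0 z2).
  assert (0 <= 1 - Cmod z1 * Cmod z2)%R by nra.
  assert (0 <= (1 - Cmod z1 * Cmod z2) * ((1 - Cmod z1) * (1 - Cmod z2)))%R
    by (repeat apply Rmult_le_pos; lra).
  nra.
Qed.

(** The strict form is an open condition, from which [Gamma_interior] obtains a neighbourhood. *)
Lemma open_disc_defect (z1 z2 : C) : (Cmod z1 < 1)%R -> (Cmod z2 < 1)%R ->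
  (Cmod ((z1 + z2) - Cconj (z1 + z2) * (z1 * z2)) + Cmod (z1 * z2) ^ 2 < 1)%R.
Proof.
  intros H1 H2. pose proof (sym_defect_le z1 z2 ltac:(lra) ltac:(lra)) as H.
  rewrite Cmod_mult in *.
  pose proof (Cmod_ge_0 z1). pose proof (Cmod_ge_0 z2).
  set (a := Cmod z1) in *. set (b := Cmod z2) in *.
  assert (0 < 1 - a * b)%R by nra.
  assert (0 < (1 - a * b) * ((1 - a) * (1 - b)))%R
    by (repeat apply Rmult_lt_0_compat; lra).
  nra.
Qed.

(* Equations and an inequality instead of an existential, so that closedness is
   immediate; [Cmod (fst x) <= 2] excludes roots [z1, z2] with [|z1| > 1] and
   [z2 = 1 / conj z1]. *)
Definition torus_image (x : C * C) : Prop :=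
  Cmod (snd x) = 1%R /\ fst x - Cconj (fst x) * snd x = 0 /\ (Cmod (fst x) <= 2)%R.

(* If [a = |z1| > 1], then [b = |z2| = 1 / a] and
   [|z1 + z2| (1 - b^2) = b (a^2 - b^2)] forces [|z1 + z2| > 2]. *)
Lemma unimodular_root (z1 z2 : C) : Cmod (z1 * z2) = 1%R ->
  (z1 + z2) - Cconj (z1 + z2) * (z1 * z2) = 0 -> (Cmod (z1 + z2) <= 2)%R ->
  (Cmod z1 <= 1)%R.
Proof.
  rewrite sym_defect, Cmod_mult. intros Hp H Hs.
  apply Rnot_lt_le. intros Ha.
  pose proof (Cmod_ge_0 z2) as Hb0.
  set (a := Cmod z1) in *. set (b := Cmod z2) in *.
  assert (Hb : (b < 1)%R) by nra.
  assert (E : (z1 + z2) * RtoC (1 - b ^ 2) = z2 * RtoC (a ^ 2 - b ^ 2)).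
  { replace ((z1 + z2) * RtoC (1 - b ^ 2)) with
      (z1 * RtoC (1 - b ^ 2) + z2 * RtoC (1 - a ^ 2) + z2 * RtoC (a ^ 2 - b ^ 2))
      by (rewrite !RtoC_minus; ring).
    rewrite H. ring. }
  apply (f_equal Cmod) in E. rewrite !Cmod_mult_RtoC in E by nra. fold b in E.
  assert (Hb1 : (0 < b)%R) by nra.
  assert (E2 : (b * (Cmod (z1 + z2) * (1 - b ^ 2)) = 1 - b ^ 4)%R).
  { rewrite E. replace (b * (b * (a ^ 2 - b ^ 2)))%R with ((a * b) ^ 2 - b ^ 4)%R by ring.
    rewrite Hp. ring. }
  assert (0 < 1 - b ^ 2)%R by nra.
  assert (0 < b * (1 - b ^ 2))%R by (apply Rmult_lt_0_compat; assumption).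
  assert (1 - b ^ 4 <= 2 * (b * (1 - b ^ 2)))%R by nra.
  (* The previous line says that this same product is at most 0. *)
  assert (0 < (1 - b ^ 2) * ((1 - b) * (1 - b)))%R
    by (repeat apply Rmult_lt_0_compat; lra).
  nra.
Qed.

Lemma torus_image_roots (x : C * C) : torus_image x ->
  exists z1 z2, Cmod z1 = 1%R /\ Cmod z2 = 1%R /\ x = (z1 + z2, z1 * z2).
Proof.
  destruct x as [s p]. unfold torus_image; cbn [fst snd].
  destruct (quadratic_roots s p) as (z1 & z2 & -> & ->). intros (Hp & Hd & Hs).
  pose proof (unimodular_root z1 z2 Hp Hd Hs) as H1.
  assert (H2 : (Cmod z2 <= 1)%R).
  { apply (unimodular_root z2 z1).
    - now rewrite Cmult_comm.
    - now rewrite Cplus_comm, (Cmult_comm z2 z1).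
    - now rewrite Cplus_comm. }
  rewrite Cmod_mult in Hp. pose proof (Cmod_ge_0 z1). pose proof (Cmod_ge_0 z2).
  exists z1, z2. split; [nra|split; [nra|reflexivity]].
Qed.

Lemma torus_image_unimodular (z1 z2 : C) : Cmod z1 = 1%R -> Cmod z2 = 1%R ->
  torus_image (z1 + z2, z1 * z2).
Proof.
  intros H1 H2. unfold torus_image; cbn [fst snd]. split; [|split].
  - rewrite Cmod_mult, H1, H2. ring.
  - rewrite sym_defect, H1, H2. replace (1 - 1 ^ 2)%R with 0%R by ring. ring.
  - pose proof (Cmod_triangle z1 z2). lra.
Qed.

(** * Continuity of complex operations *)

Lemma continuous_C {T : UniformSpace} (f g : T -> R) (t : T) :
  continuous f t -> continuous g t ->
  continuous (U := C_UniformSpace) (fun t => (f t, g t)) t.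
Proof.
  intros Hf Hg. apply filterlim_locally. intros eps.
  pose proof (proj1 (filterlim_locally _ _) Hf eps) as Ef.
  pose proof (proj1 (filterlim_locally _ _) Hg eps) as Eg.
  generalize (filter_and _ _ Ef Eg). apply filter_imp. intros x [? ?]. now split.
Qed.

Lemma continuous_C_fst {T : UniformSpace} (f : T -> C) (t : T) :
  continuous (U := C_UniformSpace) f t -> continuous (fun t => fst (f t)) t.
Proof.
  intros Hf. apply (continuous_comp (V := C_UniformSpace) f fst); [assumption|].
  destruct (f t). apply (continuous_fst (U := R_UniformSpace) (V := R_UniformSpace)).
Qed.

Lemma continuous_C_snd {T : UniformSpace} (f : T -> C) (t : T) :
  continuous (U := C_UniformSpace) f t -> continuous (fun t => snd (f t)) t.
Proof.
  intros Hf. apply (continuous_comp (V := C_UniformSpace) f snd); [assumption|].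
  destruct (f t). apply (continuous_snd (U := R_UniformSpace) (V := R_UniformSpace)).
Qed.

Lemma continuous_Rplus {T : UniformSpace} (f g : T -> R) (t : T) :
  continuous f t -> continuous g t -> continuous (fun t => f t + g t)%R t.
Proof. apply (continuous_plus (V := R_NormedModule)). Qed.

Lemma continuous_Ropp {T : UniformSpace} (f : T -> R) (t : T) :
  continuous f t -> continuous (fun t => - f t)%R t.
Proof. apply (continuous_opp (V := R_NormedModule)). Qed.

Lemma continuous_Rmult {T : UniformSpace} (f g : T -> R) (t : T) :
  continuous f t -> continuous g t -> continuous (fun t => f t * g t)%R t.
Proof. apply (continuous_mult (K := R_AbsRing)). Qed.

Lemma continuous_Cplus {T : UniformSpace} (f g : T -> C) (t : T) :
  continuous (U := C_UniformSpace) f t -> continuous (U := C_UniformSpace) g t ->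
  continuous (U := C_UniformSpace) (fun t => f t + g t) t.
Proof.
  intros Hf Hg. apply continuous_C; apply continuous_Rplus;
    auto using continuous_C_fst, continuous_C_snd.
Qed.

Lemma continuous_Cminus {T : UniformSpace} (f g : T -> C) (t : T) :
  continuous (U := C_UniformSpace) f t -> continuous (U := C_UniformSpace) g t ->
  continuous (U := C_UniformSpace) (fun t => f t - g t) t.
Proof.
  intros Hf Hg. apply continuous_C; apply continuous_Rplus; try apply continuous_Ropp;
    auto using continuous_C_fst, continuous_C_snd.
Qed.

Lemma continuous_Cmult {T : UniformSpace} (f g : T -> C) (t : T) :
  continuous (U := C_UniformSpace) f t -> continuous (U := C_UniformSpace) g t ->
  continuous (U := C_UniformSpace) (fun t => f t * g t) t.
Proof.
  intros Hf Hg. apply continuous_C; unfold Rminus;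
    auto 6 using continuous_C_fst, continuous_C_snd, continuous_Rplus,
      continuous_Rmult, continuous_Ropp.
Qed.

Lemma continuous_Cmod {T : UniformSpace} (f : T -> C) (t : T) :
  continuous (U := C_UniformSpace) f t -> continuous (fun t => Cmod (f t)) t.
Proof.
  intros Hf. unfold Cmod. apply continuous_comp with (g := sqrt).
  - apply continuous_ext with
      (fun t => fst (f t) * fst (f t) + snd (f t) * snd (f t))%R;
      [intros s; simpl; ring|].
    auto using continuous_C_fst, continuous_C_snd, continuous_Rplus, continuous_Rmult.
  - apply continuous_sqrt.
Qed.

Lemma continuous_Cinv {T : UniformSpace} (f : T -> C) (t : T) :
  continuous (U := C_UniformSpace) f t -> f t <> 0 ->
  continuous (U := C_UniformSpace) (fun t => / f t) t.
Proof.
  intros Hf H0.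
  assert (Hc : continuous (fun t => / (fst (f t) ^ 2 + snd (f t) ^ 2))%R t).
  { apply continuous_ext with
      (fun t => / (fst (f t) * fst (f t) + snd (f t) * snd (f t)))%R;
      [intros; apply (f_equal Rinv (x := (_ : R))); ring|].
    apply continuous_comp with (g := Rinv).
    - auto using continuous_C_fst, continuous_C_snd, continuous_Rplus, continuous_Rmult.
    - apply continuous_Rinv. intros E. apply H0. destruct (f t) as [x y]. cbn in E.
      assert (x = 0)%R by nra. assert (y = 0)%R by nra. subst. reflexivity. }
  apply continuous_C; unfold Rdiv;
    auto using continuous_C_fst, continuous_C_snd, continuous_Rmult, continuous_Ropp.
Qed.

Lemma continuous_Cconj {T : UniformSpace} (f : T -> C) (t : T) :
  continuous (U := C_UniformSpace) f t ->
  continuous (U := C_UniformSpace) (fun t => Cconj (f t)) t.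
Proof.
  intros Hf. apply continuous_C;
    auto using continuous_C_fst, continuous_C_snd, continuous_Ropp.
Qed.

Lemma continuous_cexp {T : UniformSpace} (f g : T -> R) (t : T) :
  continuous f t -> continuous g t ->
  continuous (U := C_UniformSpace) (fun t => cexp (f t, g t)) t.
Proof.
  intros Hf Hg. unfold cexp; cbn [fst snd].
  assert (He : continuous (fun t => exp (f t)) t)
    by (apply continuous_comp with (g := exp); [assumption|apply continuous_exp]).
  apply continuous_C; apply continuous_Rmult; try assumption.
  - apply continuous_comp with (g := cos); [assumption|apply continuous_cos].
  - apply continuous_comp with (g := sin); [assumption|apply continuous_sin].
Qed.

Lemma continuous_pair {T U V : UniformSpace} (f : T -> U) (g : T -> V) (t : T) :
  continuous f t -> continuous g t -> continuous (fun t => (f t, g t)) t.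
Proof.
  intros Hf Hg. apply filterlim_locally. intros eps.
  pose proof (proj1 (filterlim_locally _ _) Hf eps) as Ef.
  pose proof (proj1 (filterlim_locally _ _) Hg eps) as Eg.
  generalize (filter_and _ _ Ef Eg). apply filter_imp. intros x [? ?]. now split.
Qed.

Lemma continuous_fst_pt {U V : UniformSpace} (x : U * V) : continuous fst x.
Proof. destruct x. apply continuous_fst. Qed.

Lemma continuous_snd_pt {U V : UniformSpace} (x : U * V) : continuous snd x.
Proof. destruct x. apply continuous_snd. Qed.

Definition defect (x : C * C) : C := fst x - Cconj (fst x) * snd x.

Lemma continuous_defect (x : C * C) :
  continuous (U := C_UniformSpace) defect x.
Proof.
  unfold defect.
  apply continuous_Cminus; [apply continuous_fst_pt|].
  apply continuous_Cmult; [apply continuous_Cconj, continuous_fst_pt|apply continuous_snd_pt].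
Qed.

(** The strict defect inequality persists nearby by continuity, and [Gamma_of_defect] puts those
    points in [Gamma]. Differentiability of functions in the algebra is available at such points. *)
Lemma Gamma_interior (z1 z2 : C) : (Cmod z1 < 1)%R -> (Cmod z2 < 1)%R ->
  locally (z1 + z2, z1 * z2) Gamma.
Proof.
  intros H1 H2.
  pose proof (open_disc_defect z1 z2 H1 H2) as H.
  assert (Hc : continuous
    (fun x : C * C => Cmod (defect x) + Cmod (snd x) * Cmod (snd x))%R
    (z1 + z2, z1 * z2)).
  { apply continuous_Rplus; [|apply continuous_Rmult]; apply continuous_Cmod;
      solve [apply continuous_defect | apply continuous_snd_pt]. }
  specialize (Hc (fun r => r < 1)%R). unfold filtermap in Hc.
  assert (L : locally (z1 + z2, z1 * z2)
    (fun x : C * C => Cmod (defect x) + Cmod (snd x) * Cmod (snd x) < 1)%R).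
  { apply Hc. apply open_lt. unfold defect; cbn [fst snd]. lra. }
  revert L. apply filter_imp. intros [s p] Hx. unfold defect in Hx; cbn [fst snd] in Hx.
  pose proof (Cmod_ge_0 p). pose proof (Cmod_ge_0 (s - Cconj s * p)).
  apply Gamma_of_defect; nra.
Qed.

Lemma closed_torus_image : closed torus_image.
Proof.
  apply closed_and; [|apply closed_and].
  - apply (closed_comp (fun x : C * C => Cmod (snd x)) (fun r => r = 1%R)); [|apply closed_eq].
    intros x. apply (continuous_Cmod (T := prod_UniformSpace C_UniformSpace C_UniformSpace)).
    apply continuous_snd_pt.
  - apply closed_ext with (fun x : C * C => Cmod (defect x) = 0%R).
    + intros x. fold (defect x). split; [apply Cmod_eq_0|intros ->; apply Cmod_0].
    + apply (closed_comp (fun x : C * C => Cmod (defect x)) (fun r => r = 0%R)); [|apply closed_eq].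
      intros x. apply (continuous_Cmod (T := prod_UniformSpace C_UniformSpace C_UniformSpace)).
      apply continuous_defect.
  - apply (closed_comp (fun x : C * C => Cmod (fst x)) (fun r => r <= 2)%R); [|apply closed_le].
    intros x. apply (continuous_Cmod (T := prod_UniformSpace C_UniformSpace C_UniformSpace)).
    apply continuous_fst_pt.
Qed.

(** * The maximum principle *)

(** For |a| < 1, the disc automorphism normalized to take 0 to [a]. *)
Definition moebius (a z : C) : C := (z + a) * / (1 + Cconj a * z).

(** Compares numerator and denominator: this one identity shows that both the open disc and the unit
    circle are preserved. *)
Lemma moebius_defect (a z : C) :
  (Cmod (1 + Cconj a * z) ^ 2 - Cmod (z + a) ^ 2 =
   (1 - Cmod a ^ 2) * (1 - Cmod z ^ 2))%R.
Proof.
  rewrite !Cmod2_alt. destruct a as [a b], z as [x y].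
  unfold Re, Im, Cconj, Cplus, Cmult, RtoC; cbn [fst snd]. ring.
Qed.

Lemma moebius_denom (a z : C) : (Cmod a < 1)%R -> (Cmod z <= 1)%R ->
  1 + Cconj a * z <> 0.
Proof.
  intros Ha Hz E.
  assert (E2 : Cconj a * z = - (1)).
  { replace (Cconj a * z) with (1 + Cconj a * z - 1) by ring. rewrite E. ring. }
  apply (f_equal Cmod) in E2. rewrite Cmod_mult, Cmod_conj, Cmod_m1 in E2.
  pose proof (Cmod_ge_0 a). pose proof (Cmod_ge_0 z). nra.
Qed.

Lemma Cmod_moebius (a z : C) : (Cmod a < 1)%R -> (Cmod z <= 1)%R ->
  (0 < Cmod (1 + Cconj a * z))%R /\
  (Cmod (moebius a z) * Cmod (1 + Cconj a * z) = Cmod (z + a))%R.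
Proof.
  intros Ha Hz. pose proof (moebius_denom a z Ha Hz) as Hd.
  pose proof (proj1 (Cmod_gt_0 _) Hd) as Hp. split; [assumption|].
  unfold moebius. rewrite Cmod_mult, Cmod_inv by assumption. field. lra.
Qed.

Lemma Cmod_moebius_lt (a z : C) : (Cmod a < 1)%R -> (Cmod z < 1)%R ->
  (Cmod (moebius a z) < 1)%R.
Proof.
  intros Ha Hz. destruct (Cmod_moebius a z) as [Hp E]; [lra|lra|].
  pose proof (moebius_defect a z) as D.
  pose proof (Cmod_ge_0 a). pose proof (Cmod_ge_0 z). pose proof (Cmod_ge_0 (z + a)).
  assert (0 < (1 - Cmod a ^ 2) * (1 - Cmod z ^ 2))%R by (apply Rmult_lt_0_compat; nra).
  apply Rnot_le_lt. intros Hge.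
  assert (Cmod (1 + Cconj a * z) <= Cmod (z + a))%R by nra. nra.
Qed.

Lemma Cmod_moebius_eq (a z : C) : (Cmod a < 1)%R -> Cmod z = 1%R ->
  Cmod (moebius a z) = 1%R.
Proof.
  intros Ha Hz. destruct (Cmod_moebius a z) as [Hp E]; [lra|lra|].
  pose proof (moebius_defect a z) as D. rewrite Hz in D.
  pose proof (Cmod_ge_0 (z + a)).
  assert (Cmod (1 + Cconj a * z) = Cmod (z + a)) by nra.
  apply Rmult_eq_reg_r with (Cmod (1 + Cconj a * z)); lra.
Qed.

Lemma Cmod_moebius_le (a z : C) : (Cmod a < 1)%R -> (Cmod z <= 1)%R ->
  (Cmod (moebius a z) <= 1)%R.
Proof.
  intros Ha [Hz|Hz].
  - now apply Rlt_le, Cmod_moebius_lt.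
  - now apply Req_le, Cmod_moebius_eq.
Qed.

Lemma moebius_0 (a : C) : moebius a 0 = a.
Proof. unfold moebius. rewrite Cmult_0_r, Cplus_0_l, Cplus_0_r. field. Qed.

Lemma cdiff_moebius (a z : C) : (Cmod a < 1)%R -> (Cmod z <= 1)%R ->
  exists l, cdiff (moebius a) z l.
Proof.
  intros Ha Hz. eexists. unfold moebius.
  apply cdiff_mult.
  - apply cdiff_plus; [apply cdiff_id|apply cdiff_const].
  - apply (cdiff_comp Cinv (fun z => 1 + Cconj a * z)).
    + apply cdiff_inv. now apply moebius_denom.
    + apply cdiff_plus; [apply cdiff_const|].
      apply cdiff_mult; [apply cdiff_const|apply cdiff_id].
Qed.

Lemma continuous_moebius {T : UniformSpace} (a : C) (f : T -> C) (t : T) :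
  (Cmod a < 1)%R -> (Cmod (f t) <= 1)%R ->
  continuous (U := C_UniformSpace) f t ->
  continuous (U := C_UniformSpace) (fun t => moebius a (f t)) t.
Proof.
  intros Ha Ht Hf. unfold moebius. apply continuous_Cmult.
  - apply continuous_Cplus; [assumption|apply continuous_const].
  - apply continuous_Cinv; [|now apply moebius_denom].
    apply continuous_Cplus; [apply continuous_const|].
    apply continuous_Cmult; [apply continuous_const|assumption].
Qed.

Definition sym (z1 z2 : C) : C * C := (z1 + z2, z1 * z2).

(** [continuous_on] controls [f] only along [Gamma]. Since [u] and [v] stay in the closed disc for
    every parameter, the relative limit becomes an ordinary one on [T]. *)
Lemma continuous_on_Gamma_sym {T : UniformSpace} (f : C * C -> C) (u v : T -> C) (t : T) :
  continuous_on Gamma f ->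
  (forall t, (Cmod (u t) <= 1)%R) -> (forall t, (Cmod (v t) <= 1)%R) ->
  continuous (U := C_UniformSpace) u t -> continuous (U := C_UniformSpace) v t ->
  continuous (fun t => Cmod (f (sym (u t) (v t)))) t.
Proof.
  intros Hf Hu Hv Cu Cv.
  assert (HG : forall t, Gamma (sym (u t) (v t))) by (intros; now exists (u t0), (v t0)).
  apply (continuous_Cmod (fun t => f (sym (u t) (v t)))).
  eapply filterlim_comp; [|apply Hf, HG].
  assert (Hc : continuous (fun t => sym (u t) (v t)) t).
  { apply (continuous_pair (U := C_UniformSpace) (V := C_UniformSpace)).
    - now apply continuous_Cplus.
    - now apply continuous_Cmult. }
  intros P HP. specialize (Hc _ HP). revert Hc. unfold filtermap. apply filter_imp.
  intros s Hs. apply Hs. apply HG.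
Qed.

(** Each point of the segment x = 0 has a square on which k < M + eps; compactness of [a, b] makes
    the width uniform. *)
Lemma tube (k : R * R -> R) (a b M eps : R) : (0 < eps)%R ->
  (forall y, continuous k (0%R, y)) -> (forall y, (k (0%R, y) <= M)%R) ->
  exists d, (0 < d)%R /\ forall x y, (Rabs x < d)%R -> (a <= y <= b)%R ->
    (k (x, y) <= M + eps)%R.
Proof.
  intros Heps Hk HM.
  assert (Hloc : forall t, exists d : posreal, forall x y,
    (Rabs x < d)%R -> (Rabs (y - t) < d)%R -> (k (x, y) < M + eps)%R).
  { intros t. specialize (Hk t (fun r => r < M + eps)%R). unfold filtermap in Hk.
    destruct Hk as [d Hd].
    { apply open_lt. apply Rle_lt_trans with M; [apply HM|lra]. }
    exists d. intros x y Hx Hy. apply Hd. split; [|exact Hy].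
    change (Rabs (x - 0) < d)%R. now rewrite Rminus_0_r. }
  pose (delta := fun t => proj1_sig (constructive_indefinite_description _ (Hloc t))).
  destruct (compactness_value_1d a b delta) as [d Hd].
  exists d. split; [apply cond_pos|]. intros x y Hx Hy.
  (* Compactness supplies its covering point under a double negation, hence the argument by
     contradiction. *)
  apply Rnot_lt_le. intros Hlt. apply (Hd y Hy).
  intros (t & Ht & H1 & H2).
  pose proof (proj2_sig (constructive_indefinite_description _ (Hloc t)) x y
    (Rlt_le_trans _ _ _ Hx H2) H1). lra.
Qed.

(** Without a maximum every [q] has a point [big q] of larger value, which still beats all points
    near [q]. In a finite subcover let [m] be at least as good as all the [big t]; then [m] is near
    some [t], so k m < k (big t) <= k m. *)
Lemma max_on_square (k : R * R -> R) (a b : R) : (a <= b)%R ->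
  (forall q, continuous k q) ->
  exists q, (a <= fst q <= b)%R /\ (a <= snd q <= b)%R /\
    forall r, (a <= fst r <= b)%R -> (a <= snd r <= b)%R -> (k r <= k q)%R.
Proof.
  intros Hab Hk.
  pose (sq := fun q : R * R => (a <= fst q <= b)%R /\ (a <= snd q <= b)%R).
  destruct (classic (exists q, sq q /\ forall r, sq r -> (k r <= k q)%R)) as [H|Hno].
  { destruct H as (q & [q1 q2] & Hq). exists q. repeat split; try tauto.
    intros r r1 r2. apply Hq. now split. }
  exfalso.
  assert (Hbig : forall q, exists q' : R * R, sq q -> sq q' /\ (k q < k q')%R).
  { intros q. destruct (classic (exists q', sq q' /\ (k q < k q')%R)) as [[q' H]|Hn].
    - exists q'. tauto.
    - exists q. intros Hq. exfalso. apply Hno. exists q. split; [assumption|].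
      intros r Hr. apply Rnot_lt_le. intros Hlt. apply Hn. now exists r. }
  pose (big := fun q => proj1_sig (constructive_indefinite_description _ (Hbig q))).
  assert (Hb : forall q, sq q -> sq (big q) /\ (k q < k (big q))%R)
    by (intros q; exact (proj2_sig (constructive_indefinite_description _ (Hbig q)))).
  assert (Hloc : forall q, exists d : posreal, forall r, sq q ->
    (Rabs (fst r - fst q) < d)%R -> (Rabs (snd r - snd q) < d)%R -> (k r < k (big q))%R).
  { intros q. destruct (classic (sq q)) as [Hq|Hq];
      [|exists (mkposreal 1 Rlt_0_1); tauto].
    pose proof (Hk q (fun x => x < k (big q))%R) as Hc. unfold filtermap in Hc.
    destruct Hc as [d Hd].
    { apply open_lt. now apply Hb. }
    exists d. intros r _ H1 H2. apply Hd. now split. }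
  pose (delta := fun t : Compactness.Tn 2 R =>
    proj1_sig (constructive_indefinite_description _ (Hloc (fst t, fst (snd t))))).
  apply (compactness_list 2 (a, (a, tt)) (b, (b, tt)) delta).
  intros [l Hl].
  assert (Hmax : forall l : list (R * R), exists m, sq m /\
    forall t, List.In t l -> sq t -> (k (big t) <= k m)%R).
  { clear l Hl. induction l as [|t l [m [Hm IH]]].
    (* For the empty list any point of the square serves; this corner is one because a <= b. *)
    - exists (a, a). split; [split; simpl; lra|]. intros t [].
    - destruct (Rle_dec (k (big t)) (k m)) as [Hle|Hle].
      + exists m. split; [assumption|]. intros t' [<-|Ht']; auto.
      + destruct (classic (sq t)) as [Hs|Hs].
        * exists (big t). split; [now apply Hb|]. intros t' [<-|Ht'] Hst; [lra|].
          specialize (IH t' Ht' Hst). lra.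
        * exists m. split; [assumption|]. intros t' [<-|Ht']; [tauto|auto]. }
  destruct (Hmax (List.map (fun t => (fst t, fst (snd t))) l)) as [m [Hm Hmm]].
  destruct (Hl (fst m, (snd m, tt))) as ([t1 [t2 []]] & Hin & Hbt & Hcl).
  { simpl. destruct Hm. tauto. }
  simpl in Hbt, Hcl.
  assert (Hst : sq (t1, t2)) by (split; simpl; tauto).
  pose proof (Hmm (t1, t2) (List.in_map (fun t => (fst t, fst (snd t))) _ _ Hin) Hst) as H1.
  destruct Hcl as (C1 & C2 & _).
  pose proof (proj2_sig (constructive_indefinite_description _ (Hloc (t1, t2))) m Hst C1 C2).
  lra.
Qed.

Lemma unimodular_cexp (z : C) : Cmod z = 1%R ->
  exists y, (0 <= y <= 2 * PI)%R /\ z = cexp (0%R, y).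
Proof.
  destruct z as [x y]. intros Hz.
  assert (E : (x ^ 2 + y ^ 2 = 1)%R).
  { pose proof (Cmod2_alt (x, y)) as H. rewrite Hz in H. cbn [Re Im fst snd] in H. lra. }
  assert (Hx : (-1 <= x <= 1)%R) by nra.
  pose proof (acos_bound x) as Hac. pose proof PI_RGT_0.
  assert (Hs : (sin (acos x) = Rabs y)%R).
  { rewrite sin_acos by assumption. rewrite <- sqrt_Rsqr_abs. f_equal. unfold Rsqr. lra. }
  destruct (Rle_dec 0 y) as [Hy|Hy].
  - exists (acos x). split; [lra|]. unfold cexp; cbn [fst snd].
    rewrite exp_0, cos_acos, Hs, Rabs_pos_eq by lra. f_equal; ring.
  (* In the lower half-plane the angle is reflected, then shifted by a full turn into [0, 2 pi]. *)
  - exists (- acos x + 2 * PI)%R. split; [lra|]. unfold cexp; cbn [fst snd].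
    rewrite exp_0, cos_plus, sin_plus, cos_2PI, sin_2PI.
    rewrite cos_neg, sin_neg, cos_acos, Hs, Rabs_left by lra. f_equal; ring.
Qed.

Lemma cexp_2PI (x : R) : cexp (x, 2 * PI)%R = cexp (x, 0%R).
Proof. unfold cexp; cbn [fst snd]. now rewrite cos_2PI, sin_2PI, cos_0, sin_0. Qed.

(* Moebius maps send the unit disc to a disc through [(z1, z2)] in the bidisc
   whose boundary circle lies on the torus. *)
Lemma max_principle_open (f : C * C -> C) (M : R) : holo_algebra Gamma f ->
  (forall w1 w2, Cmod w1 = 1%R -> Cmod w2 = 1%R -> (Cmod (f (sym w1 w2)) <= M)%R) ->
  forall z1 z2, (Cmod z1 < 1)%R -> (Cmod z2 < 1)%R -> (Cmod (f (sym z1 z2)) <= M)%R.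
Proof.
  intros [Hc Hd] HM z1 z2 H1 H2.
  set (h := fun w => f (sym (moebius z1 w) (moebius z2 w))).
  assert (Hh : forall w, (Cmod w < 1)%R -> exists l, cdiff h w l).
  { intros w Hw.
    destruct (cdiff_moebius z1 w) as [a Ha]; [lra|lra|].
    destruct (cdiff_moebius z2 w) as [b Hb]; [lra|lra|].
    destruct (ex_filterdiff_prod_diff f (sym (moebius z1 w) (moebius z2 w)))
      as (l1 & l2 & Hl).
    { apply Hd. apply Gamma_interior; now apply Cmod_moebius_lt. }
    eexists. apply (cdiff_prod_comp f (fun w => moebius z1 w + moebius z2 w)
      (fun w => moebius z1 w * moebius z2 w) w l1 l2); [exact Hl| |].
    - now apply cdiff_plus; [apply Ha|apply Hb].
    - now apply cdiff_mult; [apply Ha|apply Hb]. }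
  assert (Hexp : forall w, (fst w < 0)%R -> (Cmod (cexp w) < 1)%R).
  { intros w Hw. rewrite Cmod_cexp, <- exp_0. now apply exp_increasing. }
  replace (f (sym z1 z2)) with (h 0) by (unfold h; now rewrite !moebius_0).
  apply (Cmod_le_of_vertical_means (fun w => h (cexp w))).
  - intros w Hw. destruct (Hh (cexp w) (Hexp w Hw)) as [l Hl].
    eexists. apply (cdiff_comp h cexp); [exact Hl|apply cdiff_cexp].
  - intros x. now rewrite cexp_2PI.
  - intros eps Heps. destruct (Hh 0) as [l Hl]; [rewrite Cmod_0; lra|].
    destruct (cdiff_continuous h 0 l Hl eps Heps) as [d [Hd0 Hdd]].
    (* |exp w| = exp x, so x < ln d brings exp w within [d] of the centre; subtracting 1 makes the
       inequality strict. *)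
    exists (ln d - 1)%R. intros x y Hx. apply Rlt_le, Hdd.
    replace (cexp (x, y) - 0) with (cexp (x, y)) by ring.
    rewrite Cmod_cexp; cbn [fst]. rewrite <- (exp_ln d) by assumption.
    apply exp_increasing. lra.
  - intros eps Heps.
    (* Replacing x by -|x| changes nothing for x < 0 and keeps the exponential in the closed disc on
       both sides of x = 0, as [tube] and [continuous_on_Gamma_sym] require. *)
    assert (Hle : forall q : R * R, (Cmod (cexp ((- Rabs (fst q))%R, snd q)) <= 1)%R).
    { intros q. rewrite Cmod_cexp, <- exp_0; cbn [fst].
      pose proof (Rabs_pos (fst q)) as [Hp|Hp].
      - apply Rlt_le, exp_increasing. lra.
      - rewrite <- Hp, Ropp_0. lra. }
    destruct (tube (fun q => Cmod (h (cexp ((- Rabs (fst q))%R, snd q)))) 0 (2 * PI) M eps Heps)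
      as [d [Hd0 Ht]].
    + intros y.
      assert (Hce : continuous (U := C_UniformSpace)
        (fun q : R * R => cexp ((- Rabs (fst q))%R, snd q)) (0%R, y)).
      { apply (continuous_cexp (T := prod_UniformSpace R_UniformSpace R_UniformSpace)).
        - apply continuous_Ropp. apply continuous_comp with (g := Rabs).
          + apply continuous_fst_pt.
          + apply continuous_Rabs.
        - apply continuous_snd_pt. }
      apply (continuous_on_Gamma_sym f
        (fun q : R * R => moebius z1 (cexp ((- Rabs (fst q))%R, snd q)))
        (fun q : R * R => moebius z2 (cexp ((- Rabs (fst q))%R, snd q)))).
      * assumption.
      * intros q. now apply Cmod_moebius_le.
      * intros q. now apply Cmod_moebius_le.
      * now apply (continuous_moebius (T := prod_UniformSpace R_UniformSpace R_UniformSpace)).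
      * now apply (continuous_moebius (T := prod_UniformSpace R_UniformSpace R_UniformSpace)).
    + intros y. cbn [fst snd]. rewrite Rabs_R0, Ropp_0.
      assert (Cmod (cexp (0%R, y)) = 1%R) by (rewrite Cmod_cexp; apply exp_0).
      apply HM; now apply Cmod_moebius_eq.
    + exists d. split; [assumption|]. intros x y Hx Hy.
      specialize (Ht x y). cbn [fst snd] in Ht. rewrite Rabs_left, Ropp_involutive in Ht by lra.
      apply Ht; [lra|assumption].
Qed.

(** A point of the closed bidisc is a radial limit of points of the open one, and [f] is continuous
    on [Gamma]. *)
Lemma max_principle (f : C * C -> C) (M : R) : holo_algebra Gamma f ->
  (forall w1 w2, Cmod w1 = 1%R -> Cmod w2 = 1%R -> (Cmod (f (sym w1 w2)) <= M)%R) ->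
  forall x, Gamma x -> (Cmod (f x) <= M)%R.
Proof.
  intros Hf HM x (z1 & z2 & H1 & H2 & ->). fold (sym z1 z2).
  (* A radius that is 1 at t = 0 and below 1 for every other [t] of either sign, so the path stays
     in [Gamma] on a full neighbourhood of 0. *)
  set (r := fun t : R => (/ (1 + t * t))%R).
  assert (Hr : forall t, (0 < r t <= 1)%R).
  { intros t. unfold r. split.
    - apply Rinv_0_lt_compat. nra.
    - rewrite <- Rinv_1 at 2. apply Rinv_le_contravar; nra. }
  assert (Hrlt : forall t, t <> 0%R -> (r t < 1)%R).
  { intros t Ht. unfold r. rewrite <- Rinv_1 at 2. apply Rinv_lt_contravar; nra. }
  assert (Hcr : continuous r 0%R).
  { apply continuous_Rinv_comp; [|lra].
    apply continuous_Rplus; [apply continuous_const|].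
    apply continuous_Rmult; apply continuous_id. }
  assert (Hz : forall z, (Cmod z <= 1)%R -> forall t, (Cmod (z * RtoC (r t)) <= 1)%R).
  { intros z Hz t. specialize (Hr t). rewrite Cmod_mult_RtoC by lra.
    pose proof (Cmod_ge_0 z). nra. }
  assert (Hcz : forall z, continuous (U := C_UniformSpace) (fun t => z * RtoC (r t)) 0%R).
  { intros z. apply continuous_Cmult; [apply continuous_const|].
    apply continuous_C; [assumption|apply continuous_const]. }
  pose proof (continuous_on_Gamma_sym f (fun t => z1 * RtoC (r t)) (fun t => z2 * RtoC (r t))
    0%R (proj1 Hf) (Hz z1 H1) (Hz z2 H2) (Hcz z1) (Hcz z2)) as Hk.
  assert (E0 : r 0%R = 1%R) by (unfold r; field).
  apply Rnot_lt_le. intros Hlt.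
  specialize (Hk (fun y => M < y)%R). unfold filtermap in Hk.
  destruct Hk as [d Hdd].
  { apply open_gt. rewrite E0, !Cmult_1_r. exact Hlt. }
  assert (Hb : ball 0%R d (d / 2)%R).
  { change (Rabs (d / 2 - 0) < d)%R. pose proof (cond_pos d).
    rewrite Rabs_pos_eq; lra. }
  specialize (Hdd _ Hb). cbv beta in Hdd.
  assert (Hd2 : (d / 2 <> 0)%R) by (pose proof (cond_pos d); lra).
  specialize (Hr (d / 2)%R). specialize (Hrlt _ Hd2).
  apply (Rlt_not_le _ _ Hdd).
  apply max_principle_open; try assumption; rewrite Cmod_mult_RtoC by lra.
  - pose proof (Cmod_ge_0 z1). nra.
  - pose proof (Cmod_ge_0 z2). nra.
Qed.

(** The maximum must be attained: the square of angles [0, 2 pi]^2 gives a maximizer over the torus,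
    and the maximum principle extends its bound to [Gamma]. *)
Lemma torus_image_closed_boundary :
  closed_boundary Gamma (holo_algebra Gamma) torus_image.
Proof.
  split; [apply closed_torus_image|]. split.
  { intros x Hx. destruct (torus_image_roots x Hx) as (z1 & z2 & H1 & H2 & ->).
    exists z1, z2. repeat split; lra. }
  intros f Hf.
  pose proof PI_RGT_0 as HPI.
  assert (Hu : forall y, Cmod (cexp (0%R, y)) = 1%R)
    by (intros; rewrite Cmod_cexp; apply exp_0).
  destruct (max_on_square
    (fun q => Cmod (f (sym (cexp (0%R, fst q)) (cexp (0%R, snd q))))) 0 (2 * PI))
    as (q & _ & _ & Hq); [lra| |].
  { intros q. apply (continuous_on_Gamma_sym f (fun q : R * R => cexp (0%R, fst q))
      (fun q : R * R => cexp (0%R, snd q))).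
    - apply Hf.
    - intros t. rewrite Hu. lra.
    - intros t. rewrite Hu. lra.
    - apply (continuous_cexp (T := prod_UniformSpace R_UniformSpace R_UniformSpace));
        [apply continuous_const|apply continuous_fst_pt].
    - apply (continuous_cexp (T := prod_UniformSpace R_UniformSpace R_UniformSpace));
        [apply continuous_const|apply continuous_snd_pt]. }
  exists (sym (cexp (0%R, fst q)) (cexp (0%R, snd q))). split.
  - now apply torus_image_unimodular.
  - apply max_principle; [assumption|]. intros w1 w2 H1 H2.
    destruct (unimodular_cexp w1 H1) as (y1 & B1 & ->).
    destruct (unimodular_cexp w2 H2) as (y2 & B2 & ->).
    exact (Hq (y1, y2) B1 B2).
Qed.

(** * Peak functions *)

Definition entire (f : C * C -> C) : Prop :=
  forall x, ex_filterdiff (K := C_AbsRing)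
    (U := prod_NormedModule C_AbsRing C_NormedModule C_NormedModule)
    (V := C_NormedModule) f (locally x).

Lemma entire_const (c : C) : entire (fun _ => c).
Proof. intros x. eexists. apply filterdiff_const. Qed.

Lemma entire_fst : entire fst.
Proof. intros x. exists fst. apply filterdiff_linear, is_linear_fst. Qed.

Lemma entire_snd : entire snd.
Proof. intros x. exists snd. apply filterdiff_linear, is_linear_snd. Qed.

Lemma entire_plus (f g : C * C -> C) : entire f -> entire g ->
  entire (fun x => f x + g x).
Proof.
  intros Hf Hg x. destruct (Hf x) as [a Ha], (Hg x) as [b Hb].
  eexists. exact (filterdiff_plus_fct f g a b Ha Hb).
Qed.

Lemma entire_minus (f g : C * C -> C) : entire f -> entire g ->
  entire (fun x => f x - g x).
Proof.
  intros Hf Hg x. destruct (Hf x) as [a Ha], (Hg x) as [b Hb].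
  eexists. exact (filterdiff_minus_fct f g a b Ha Hb).
Qed.

(* [C] is a normed module over itself through two distinct canonical
   structures, with the same operations and norm. *)
Lemma filterdiff_regular {F : (C * C -> Prop) -> Prop} (f l : C * C -> C) :
  filterdiff (K := C_AbsRing)
    (U := prod_NormedModule C_AbsRing C_NormedModule C_NormedModule)
    (V := C_NormedModule) f F l <->
  filterdiff (K := C_AbsRing)
    (U := prod_NormedModule C_AbsRing C_NormedModule C_NormedModule)
    (V := AbsRing_NormedModule C_AbsRing) f F l.
Proof.
  split; intros [[Hp Hs Hn] Hd]; (split; [split; assumption|exact Hd]).
Qed.

Lemma entire_mult (f g : C * C -> C) : entire f -> entire g ->
  entire (fun x => f x * g x).
Proof.
  intros Hf Hg x. destruct (Hf x) as [a Ha], (Hg x) as [b Hb].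
  apply filterdiff_regular in Ha, Hb.
  eexists. apply filterdiff_regular.
  exact (filterdiff_mult_fct (K := C_AbsRing) f g x a b Cmult_comm Ha Hb).
Qed.

Lemma entire_holo_algebra (K : C * C -> Prop) (f : C * C -> C) :
  entire f -> holo_algebra K f.
Proof.
  intros Hf. split; [|intros x _; apply Hf].
  intros x _. eapply filterlim_filter_le_1; [apply filter_le_within|].
  exact (filterdiff_continuous f x (Hf x)).
Qed.

(* On the torus [s = conj s * p], so this is
   [p (16 - |s - s0|^2) + 16 p0] with [|s - s0| <= 4]. *)
Definition pre_peak (s0 p0 : C) (x : C * C) : C :=
  16 * snd x - (fst x - s0) * (fst x - Cconj s0 * snd x) + 16 * p0.

Lemma entire_pre_peak (s0 p0 : C) : entire (pre_peak s0 p0).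
Proof.
  apply entire_plus; [|apply entire_const].
  apply entire_minus; apply entire_mult.
  - apply entire_const.
  - apply entire_snd.
  - apply entire_minus; [apply entire_fst|apply entire_const].
  - apply entire_minus; [apply entire_fst|].
    apply entire_mult; [apply entire_const|apply entire_snd].
Qed.

Lemma pre_peak_torus (s0 p0 : C) (x : C * C) : torus_image x ->
  pre_peak s0 p0 x = snd x * RtoC (16 - Cmod (fst x - s0) ^ 2) + 16 * p0.
Proof.
  intros (_ & Hd & _). destruct x as [s p]; unfold pre_peak; cbn [fst snd] in *.
  rewrite RtoC_minus, Cmod2_conj, Cminus_conj.
  (* The first summand vanishes on the torus; what remains is conj (s - s0) p. *)
  replace (s - Cconj s0 * p) with (s - Cconj s * p + (Cconj s - Cconj s0) * p) by ring.
  rewrite Hd. ring.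
Qed.

Lemma torus_dist (s0 p0 : C) (x : C * C) : torus_image (s0, p0) -> torus_image x ->
  (0 <= 16 - Cmod (fst x - s0) ^ 2)%R.
Proof.
  intros (_ & _ & H0) (_ & _ & Hx). cbn [fst] in H0.
  pose proof (Cmod_triangle (fst x) (- s0)) as T. rewrite Cmod_opp in T.
  change (fst x + - s0) with (fst x - s0) in T.
  pose proof (Cmod_ge_0 (fst x - s0)). nra.
Qed.

Lemma Cmod_parallelogram (a b : C) :
  (Cmod (a + b) ^ 2 + Cmod (a - b) ^ 2 = 2 * (Cmod a ^ 2 + Cmod b ^ 2))%R.
Proof.
  rewrite !Cmod2_alt. destruct a, b.
  unfold Re, Im, Cminus, Cplus, Copp; cbn [fst snd]. ring.
Qed.

Lemma pre_peak_le (s0 p0 : C) : torus_image (s0, p0) ->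
  forall x, Gamma x -> (Cmod (pre_peak s0 p0 x) <= 32)%R.
Proof.
  intros H0. apply max_principle.
  - apply entire_holo_algebra, entire_pre_peak.
  - intros w1 w2 H1 H2.
    assert (Hx : torus_image (sym w1 w2)) by now apply torus_image_unimodular.
    rewrite pre_peak_torus by assumption.
    eapply Rle_trans; [apply Cmod_triangle|].
    rewrite Cmod_mult_RtoC by (now apply (torus_dist s0 p0)).
    rewrite (proj1 Hx), Cmod_mult, Cmod_R, Rabs_pos_eq by lra.
    destruct H0 as [H0 _]; cbn [snd] in H0. rewrite H0.
    pose proof (pow2_ge_0 (Cmod (fst (sym w1 w2) - s0))). lra.
Qed.

(** The triangle inequality bounds the modulus by 32 - |s - s0|^2, so s = s0. Then |p + p0| >= 2 for
    unimodular p and p0, and the parallelogram law gives p = p0. *)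
Lemma pre_peak_eq (s0 p0 : C) (x : C * C) : torus_image (s0, p0) -> torus_image x ->
  (32 <= Cmod (pre_peak s0 p0 x))%R -> x = (s0, p0).
Proof.
  intros H0 Hx H. rewrite pre_peak_torus in H by assumption.
  pose proof (torus_dist s0 p0 x H0 Hx) as Hd.
  destruct x as [s p]. destruct H0 as [H0 _], Hx as [Hx _]. cbn [fst snd] in *.
  pose proof (Cmod_triangle (p * RtoC (16 - Cmod (s - s0) ^ 2)) (16 * p0)) as T.
  rewrite Cmod_mult_RtoC, Cmod_mult, Cmod_R, Rabs_pos_eq, H0, Hx in T by lra.
  assert (E : Cmod (s - s0) = 0%R) by (pose proof (Cmod_ge_0 (s - s0)); nra).
  rewrite E in H.
  replace (p * RtoC (16 - 0 ^ 2) + 16 * p0) with (16 * (p + p0)) in H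
    by (replace (16 - 0 ^ 2)%R with 16%R by ring; ring).
  rewrite Cmod_mult, Cmod_R, Rabs_pos_eq in H by lra.
  pose proof (Cmod_parallelogram p p0) as Q. rewrite H0, Hx in Q.
  assert (E2 : Cmod (p - p0) = 0%R) by (pose proof (Cmod_ge_0 (p - p0)); nra).
  apply Cmod_eq_0 in E, E2.
  f_equal; [replace s with (s - s0 + s0) by ring; rewrite E
           |replace p with (p - p0 + p0) by ring; rewrite E2]; ring.
Qed.

Lemma Gamma_torus (x : C * C) : Gamma x -> Cmod (snd x) = 1%R -> torus_image x.
Proof.
  intros (z1 & z2 & H1 & H2 & ->). cbn [snd]. rewrite Cmod_mult. intros H.
  pose proof (Cmod_ge_0 z1). pose proof (Cmod_ge_0 z2).
  apply torus_image_unimodular; nra.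
Qed.

Lemma Gamma_Cmod_snd (x : C * C) : Gamma x -> (Cmod (snd x) <= 1)%R.
Proof.
  intros (z1 & z2 & H1 & H2 & ->). cbn [snd]. rewrite Cmod_mult.
  pose proof (Cmod_ge_0 z1). pose proof (Cmod_ge_0 z2). nra.
Qed.

(** For the converse, p times [pre_peak] has modulus 32 at [(s0, p0)], hence at least 32 at some [y]
    in [E]. There the factors are at most 1 and 32, so both bounds are equalities: the first puts
    [y] on the torus, the second makes it [(s0, p0)]. *)
Lemma bGamma_torus (x : C * C) : bGamma x <-> torus_image x.
Proof.
  split.
  - intros H. exact (H _ torus_image_closed_boundary).
  - intros Hx E (_ & HE & Hmax). destruct x as [s0 p0].
    assert (Hpk : exists y : C * C, E y /\ forall x : C * C, Gamma x ->
      (Cmod (snd x * pre_peak s0 p0 x) <= Cmod (snd y * pre_peak s0 p0 y))%R).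
    { apply (Hmax (fun x => snd x * pre_peak s0 p0 x)).
      apply entire_holo_algebra, entire_mult; [apply entire_snd|apply entire_pre_peak]. }
    destruct Hpk as (y & Hy & Hle).
    assert (HG : Gamma (s0, p0)).
    { destruct (torus_image_roots _ Hx) as (z1 & z2 & H1 & H2 & ->).
      exists z1, z2. repeat split; lra. }
    specialize (Hle _ HG).
    rewrite (pre_peak_torus s0 p0 (s0, p0) Hx) in Hle. cbn [fst snd] in Hle.
    replace (s0 - s0) with (RtoC 0) in Hle by ring. rewrite Cmod_0 in Hle.
    replace (p0 * (p0 * RtoC (16 - 0 ^ 2) + 16 * p0)) with (32 * (p0 * p0)) in Hle
      by (replace (16 - 0 ^ 2)%R with 16%R by ring; ring).
    assert (Hp0 : Cmod p0 = 1%R) by apply Hx.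
    rewrite !Cmod_mult, Hp0, Cmod_R, Rabs_pos_eq in Hle by lra.
    pose proof (pre_peak_le s0 p0 Hx y (HE y Hy)) as H32.
    pose proof (Gamma_Cmod_snd y (HE y Hy)) as Hp.
    assert (Hf : (32 <= Cmod (pre_peak s0 p0 y))%R).
    { pose proof (Rmult_le_compat_r _ _ _ (Cmod_ge_0 (pre_peak s0 p0 y)) Hp). lra. }
    assert (Hy1 : Cmod (snd y) = 1%R).
    { rewrite (Rle_antisym _ _ H32 Hf) in Hle. lra. }
    rewrite <- (pre_peak_eq s0 p0 y Hx); [assumption| |assumption].
    apply Gamma_torus; [now apply HE|assumption].
Qed.

(** Within [Gamma], lying on the torus image means |p| = 1. Conversely the inequality forces |p| <=
    1, so |p| <> 1 gives the strict bound that [Gamma_of_defect] asks for. *)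
Theorem lemma5p2 (s p : C) :
  (Gamma (s, p) /\ ~ bGamma (s, p)) <->
  (Cmod p <> 1%R /\ (Cmod (s - Cconj s * p)%C + Cmod p ^ 2 <= 1)%R).
Proof.
  rewrite bGamma_torus. split.
  - intros [HG Hb]. split; [|now apply Gamma_defect].
    intros Hp. apply Hb. now apply Gamma_torus.
  - intros [Hp H]. split.
    + apply Gamma_of_defect; [|assumption].
      pose proof (Cmod_ge_0 p). pose proof (Cmod_ge_0 (s - Cconj s * p)).
      assert (Cmod p <= 1)%R by nra. lra.
    + intros [Ht _]. exact (Hp Ht).
Qed.
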